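(* Let $q\geq 2$ and $n\geq 2$. Then there is a homeomorphism \[\mathrm{Hom}(F_n/\Gamma^{q}_n,SO(3))\cong\mathrm{Hom}(\mathbb{Z}^n,SO(3))_{\mathds{1}}\sqcup \bigsqcup_{M(n)} SU(2)/Q_8\sqcup\bigsqcup_{M(n,q)} SU(2)/\mu_{4},\] with $M(n)$ copies of $SU(2)/Q_8$ and $M(n,q)$ copies of $SU(2)/\mu_4$, where \[M(n)=\frac{(2^n-1)(2^{n-1}-1)}{3}\quad\text{and}\quad M(n,q)=(2^n-1)\left(2^{(q-2)(n-1)}-1\right)2^{n-2}.\]
   Context: $F_n$ is the free group on $n$ generators; the descending central series of a group $Q$ is $\Gamma^1(Q)=Q$, $\Gamma^{k+1}(Q)=[\Gamma^k(Q),Q]$, and $\Gamma^k_n:=\Gamma^k(F_n)$. For a discrete group $\Gamma$ and a topological group $G$, $\mathrm{Hom}(\Gamma,G)$ is the set of homomorphisms topologized as a subspace of $G^\Gamma$ with the product topology; for $\Gamma$ generated by $n$ elements this agrees with its topology as a subspace of $G^n$. $\mathrm{Hom}(\mathbb{Z}^n,SO(3))_{\mathds{1}}$ is the connected component of $\mathrm{Hom}(\mathbb{Z}^n,SO(3))$ containing $(I,\ldots,I)$. $\mu_4\subset SU(2)$ is the cyclic subgroup of order $4$ generated by $\begin{pmatrix} i&0\\0&-i\end{pmatrix}$, and $Q_8=\mu_4\cup w\mu_4\subset SU(2)$ with $w=\begin{pmatrix}0&-1\\1&0\end{pmatrix}$. *)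

(* Defs.v *)
From HB Require Import structures.
From mathcomp Require Import all_boot all_order all_algebra.
From mathcomp Require Import generic_quotient spectral complex.
From mathcomp Require Import all_classical all_reals all_analysis.

Set Implicit Arguments.
Unset Strict Implicit.
Unset Printing Implicit Defensive.

Import Order.TTheory GRing.Theory Num.Theory.
Import numFieldNormedType.Exports.

Local Open Scope quotient_scope.
Local Open Scope classical_set_scope.
Local Open Scope group_scope.

HB.factory Record isGroupClosed (G : groupType) (S : {pred G}) := {
  group_closed_subproof : group_closed S
}.
HB.builders Context G S of isGroupClosed G S.
HB.instance Definition _ := isMulClosed.Build G S
  (group_closedM group_closed_subproof).
HB.instance Definition _ := isMul1Closed.Build G S group_closed_subproof.1.
HB.instance Definition _ := isInvClosed.Build G S
  (group_closedV group_closed_subproof).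
HB.end.

Section Subgroups.
Variable G : groupType.

Definition generated_subgroup (A : set G) : set G :=
  smallest (fun H : set G => group_closed [in H]) A.

Lemma group_closedE (A : set G) : group_closed [in A] <->
  A 1 /\ forall x y, A x -> A y -> A (x / y).
Proof.
split=> -[A1 AF]; split=> [|x y Ax Ay].
- exact: set_mem A1.
- by apply/set_mem/AF; apply/mem_set.
- exact: mem_set.
- by apply/mem_set/AF; apply/set_mem.
Qed.

Lemma generated_subgroup_closed (A : set G) :
  group_closed [in generated_subgroup A].
Proof.
apply/group_closedE; split=> [H /= [/group_closedE[]] //|x y Ax Ay H HA].
have [/group_closedE[_ HF] _] := HA.
by apply: HF; [exact: Ax|exact: Ay].
Qed.

Definition commutator_subgroup (A B : set G) : set G :=
  generated_subgroup [set [~ x, y] | x in A & y in B].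

(* Indexed from 1: [lower_central 1] is the whole group; the value at 0 is
   the whole group as well. *)
Definition lower_central (k : nat) : set G :=
  iter k.-1 (fun H => commutator_subgroup H setT) setT.

Definition lower_central_pred (k : nat) : {pred G} := [in lower_central k].

Fact lower_central_closed k : group_closed (lower_central_pred k).
Proof.
rewrite /lower_central_pred /lower_central; case: k.-1 => [|j] /=.
  exact/group_closedE.
exact: generated_subgroup_closed.
Qed.

HB.instance Definition _ k :=
  isGroupClosed.Build G (lower_central_pred k) (lower_central_closed k).

End Subgroups.

Arguments lower_central : clear implicits.
Arguments lower_central_pred : clear implicits.

HB.mixin Record isConjClosed (G : groupType) (S : {pred G}) := {
  conj_closed_subproof : forall x y, x \in S -> x ^ y \in S
}.

#[short(type="normalClosed")]
HB.structure Definition NormalClosed G :=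
  {S of GroupClosed G S & isConjClosed G S}.

Section LowerCentralNormal.
Variable G : groupType.

Let conj_gen (A : set G) (y : G) :
  (forall a, A a -> A (a ^ y)) ->
  forall x, generated_subgroup A x -> generated_subgroup A (x ^ y).
Proof.
move=> Ay x; apply: (@smallest_sub _ _ _
  [set x | generated_subgroup A (x ^ y)]); last first.
  by move=> a Aa /=; apply: sub_gen_smallest; apply: Ay.
have /group_closedE[g1 gF] := generated_subgroup_closed A.
apply/group_closedE; split=> [|u v] /=; first by rewrite conj1g.
by rewrite conjMg conjVg; apply: gF.
Qed.

Fact lower_central_conj k (x y : G) :
  x \in lower_central_pred G k -> x ^ y \in lower_central_pred G k.
Proof.
move=> /set_mem kx; apply/mem_set; move: kx; rewrite /lower_central.
move: k.-1 => {}k; elim: k x y => [//|k IHk] x y /=.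
apply: conj_gen => _ [a Ha [b _ <-]].
by exists (a ^ y); [exact: IHk|exists (b ^ y) => //; rewrite conjRg].
Qed.

HB.instance Definition _ k :=
  isConjClosed.Build G (lower_central_pred G k) (@lower_central_conj k).

End LowerCentralNormal.

Section Cosets.
Variables (G : groupType) (H : groupClosed G).

Definition coset_rel : rel G := fun x y => x^-1 * y \in H.

Fact coset_rel_refl : reflexive coset_rel.
Proof. by move=> x; rewrite /coset_rel mulVg gpred1. Qed.

Fact coset_rel_sym : symmetric coset_rel.
Proof. by move=> x y; rewrite /coset_rel -gpredV invgM invgK. Qed.

Fact coset_rel_trans : transitive coset_rel.
Proof.
move=> y x z; rewrite /coset_rel => Hxy Hyz.
by have := gpredM _ _ Hxy Hyz; rewrite -mulgA mulVKg.
Qed.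

Canonical coset_equiv :=
  EquivRel coset_rel coset_rel_refl coset_rel_sym coset_rel_trans.

(* The set G / H of left cosets x H. *)
Definition left_cosets : Type := {eq_quot coset_equiv}.

HB.instance Definition _ := Choice.on left_cosets.
HB.instance Definition _ := Quotient.on left_cosets.
HB.instance Definition _ : EqQuotient G coset_equiv left_cosets :=
  EqQuotient.on left_cosets.

End Cosets.

Section QuotientGroup.
Variables (G : groupType) (N : normalClosed G).

Definition quotient_group : Type := left_cosets N.

HB.instance Definition _ := Choice.on quotient_group.
HB.instance Definition _ := Quotient.on quotient_group.

Let Q := quotient_group.

Let piP (x y : G) : reflect (\pi_Q x = \pi_Q y) (x^-1 * y \in N).
Proof. exact: (@eqquotP _ (coset_equiv N) (left_cosets N) x y). Qed.

Definition quotient_mul := lift_op2 Q (fun x y : G => x * y).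
Definition quotient_inv := lift_op1 Q (fun x : G => x^-1).
Definition quotient_one := lift_cst Q (1 : G).

Let reprN (x : G) : (repr (\pi_Q x))^-1 * x \in N.
Proof. by apply/piP; rewrite reprK. Qed.

Lemma quotient_mulE (x y : G) :
  quotient_mul (\pi_Q x) (\pi_Q y) = \pi_Q (x * y).
Proof.
rewrite /quotient_mul -lock; apply/piP; set x' := repr _; set y' := repr _.
have -> : (x' * y')^-1 * (x * y) = (x'^-1 * x) ^ y' * (y'^-1 * y).
  by rewrite /conjg invgM !mulgA mulgK.
by rewrite gpredM ?reprN// conj_closed_subproof ?reprN.
Qed.

Lemma quotient_invE (x : G) : quotient_inv (\pi_Q x) = \pi_Q x^-1.
Proof.
rewrite /quotient_inv -lock; apply/piP; set x' := repr _; rewrite invgK -gpredV invgM invgK.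
have -> : x * x'^-1 = (x'^-1 * x) ^ x'^-1.
  by rewrite /conjg invgK !mulgA mulgV mul1g.
by rewrite conj_closed_subproof ?reprN.
Qed.

Fact quotient_mulA : associative quotient_mul.
Proof.
by move=> a b c; rewrite -[a]reprK -[b]reprK -[c]reprK !quotient_mulE mulgA. Qed.
Fact quotient_mul1 : left_id quotient_one quotient_mul.
Proof. by move=> a; rewrite -[a]reprK /quotient_one -lock quotient_mulE mul1g. Qed.
Fact quotient_mulr1 : right_id quotient_one quotient_mul.
Proof. by move=> a; rewrite -[a]reprK /quotient_one -lock quotient_mulE mulg1. Qed.
Fact quotient_mulV : left_inverse quotient_one quotient_inv quotient_mul.
Proof. by move=> a; rewrite -[a]reprK /quotient_one -lock quotient_invE quotient_mulE mulVg. Qed.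
Fact quotient_mulrV : right_inverse quotient_one quotient_inv quotient_mul.
Proof. by move=> a; rewrite -[a]reprK /quotient_one -lock quotient_invE quotient_mulE mulgV. Qed.

HB.instance Definition _ := isGroup.Build quotient_group
  quotient_mulA quotient_mul1 quotient_mulr1 quotient_mulV quotient_mulrV.

End QuotientGroup.

Section FreeGroup.
Variable n : nat.

(* [(i, false)] is the i-th generator and [(i, true)] its inverse. *)
Definition letter : Type := ('I_n * bool)%type.
HB.instance Definition _ := Choice.on letter.

Definition letter_inv (a : letter) : letter := (a.1, ~~ a.2).

Definition reduced (w : seq letter) : bool :=
  sorted (fun a b => b != letter_inv a) w.

Record free_group := FreeGroup {
  word_of : seq letter;
  word_of_reduced : reduced word_of
}.

HB.instance Definition _ := [isSub for word_of].
HB.instance Definition _ := [Choice of free_group by <:].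

Let push (a : letter) (w : seq letter) : seq letter :=
  if w is b :: w' then if b == letter_inv a then w' else a :: w else [:: a].

Definition reduce (w : seq letter) : seq letter := foldr push [::] w.

Let letter_invK : involutive letter_inv.
Proof. by case=> i b; rewrite /letter_inv /= negbK. Qed.

Let push_reduced a w : reduced w -> reduced (push a w).
Proof.
case: w => [//|b w] /= bw; case: eqP => [_|/eqP ba]; first exact: path_sorted bw.
by rewrite /= ba.
Qed.

Let foldr_push_reduced u w : reduced w -> reduced (foldr push w u).
Proof. by move=> rw; elim: u => //= a u; apply: push_reduced. Qed.

Let reduce_reduced w : reduced (reduce w).
Proof. exact: foldr_push_reduced. Qed.

Let reduce_id w : reduced w -> reduce w = w.
Proof.
elim: w => [//|a w IHw] /= aw; rewrite /reduce /= -/(reduce w).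
rewrite IHw; last exact: path_sorted aw.
by case: w aw {IHw} => //= b w /andP[/negPf ->].
Qed.

Let pushK a w : reduced w -> push a (push (letter_inv a) w) = w.
Proof.
case: w => [|b w] /=; first by rewrite eqxx.
rewrite letter_invK => bw; have [ba|ba] := eqVneq b a; last by rewrite /= eqxx.
case: w bw => [|c w] /=; first by rewrite ba.
by rewrite ba => /andP[/negPf ->].
Qed.

Let foldr_push a u z : reduced z ->
  foldr push z (push a u) = push a (foldr push z u).
Proof.
case: u => [//|b u] rz /=; case: eqP => [->|//].
by rewrite pushK // foldr_push_reduced.
Qed.

Let foldr_reduce u z : reduced z -> foldr push z (reduce u) = foldr push z u.
Proof. by move=> rz; elim: u => //= a u IHu; rewrite foldr_push // IHu. Qed.

Let reduce_cat u v : reduce (u ++ v) = foldr push (reduce v) u.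
Proof. by rewrite /reduce foldr_cat. Qed.

Let reduce_catl u v : reduce (reduce u ++ v) = reduce (u ++ v).
Proof. by rewrite !reduce_cat foldr_reduce. Qed.

Let reduce_catr u v : reduce (u ++ reduce v) = reduce (u ++ v).
Proof. by rewrite !reduce_cat [reduce (reduce v)]reduce_id. Qed.

Definition word_inv (w : seq letter) : seq letter := rev (map letter_inv w).

Let word_inv_reduced w : reduced w -> reduced (word_inv w).
Proof.
rewrite /reduced /word_inv rev_sorted sorted_map.
by apply: sub_sorted => a b /=; rewrite letter_invK eq_sym.
Qed.

Let word_invK : involutive word_inv.
Proof.
move=> w; rewrite /word_inv map_rev revK -map_comp.
by rewrite -[RHS]map_id; apply: eq_map => a /=; rewrite letter_invK.
Qed.

Let reduce_invr w : reduce (w ++ word_inv w) = [::].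
Proof.
elim: w => [//|a w IHw]; rewrite /word_inv /= rev_cons -cats1 catA.
rewrite -/(word_inv w) -[LHS]/(push a (reduce _)) -reduce_catl IHw /=.
by rewrite /reduce /= eqxx.
Qed.

Let reduce_invl w : reduce (word_inv w ++ w) = [::].
Proof. by rewrite -[X in _ ++ X]word_invK reduce_invr. Qed.

Definition free_one : free_group := FreeGroup (isT : reduced [::]).
Definition free_mul (x y : free_group) : free_group :=
  FreeGroup (reduce_reduced (word_of x ++ word_of y)).
Definition free_inv (x : free_group) : free_group :=
  FreeGroup (word_inv_reduced (word_of_reduced x)).

Fact free_mulA : associative free_mul.
Proof. by move=> x y z; apply: val_inj; rewrite /= reduce_catl reduce_catr catA. Qed.
Fact free_mul1 : left_id free_one free_mul.
Proof. by move=> x; apply: val_inj; rewrite /= reduce_id ?word_of_reduced. Qed.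
Fact free_mulr1 : right_id free_one free_mul.
Proof. by move=> x; apply: val_inj; rewrite /= cats0 reduce_id ?word_of_reduced. Qed.
Fact free_mulV : left_inverse free_one free_inv free_mul.
Proof. by move=> x; apply: val_inj; rewrite /= reduce_invl. Qed.
Fact free_mulrV : right_inverse free_one free_inv free_mul.
Proof. by move=> x; apply: val_inj; rewrite /= reduce_invr. Qed.

HB.instance Definition _ := isGroup.Build free_group
  free_mulA free_mul1 free_mulr1 free_mulV free_mulrV.

End FreeGroup.

HB.mixin Record GroupTopological_isTopologicalGroup G
    of Group G & Topological G := {
  mulg_continuous : continuous (fun p : G * G => (p.1 * p.2 : G));
  invg_continuous : continuous (fun x : G => x^-1)
}.

#[short(type="topologicalGroupType")]
HB.structure Definition TopologicalGroup :=
  {G of Group G & Topological G & GroupTopological_isTopologicalGroup G}.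

(* [{ptws Gamma -> G}] carries the product topology of G^Gamma. *)
Definition hom_space (Gamma : groupType) (G : topologicalGroupType) :
    set {ptws Gamma -> G} :=
  [set f : Gamma -> G | {morph f : x y / x * y}].

(* The component of the trivial homomorphism, i.e. of (1, ..., 1) when Gamma
   is finitely generated and Hom is viewed inside G^n. *)
Definition hom_component (Gamma : groupType) (G : topologicalGroupType) :
    set {ptws Gamma -> G} :=
  connected_component (@hom_space Gamma G) (fun=> 1).

Definition coset_space (G : topologicalGroupType) (H : groupClosed G) :
    topologicalType :=
  quotient_topology (left_cosets H).

Definition homeomorphic (X Y : topologicalType) : Prop :=
  exists (f : X -> Y) (g : Y -> X),
    [/\ continuous f, continuous g, cancel f g & cancel g f].

Local Open Scope ring_scope.

Section MatrixContinuity.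

Lemma continuous_mx (X Y : topologicalType) (m n : nat) (f : X -> 'M[Y]_(m, n)) :
  (forall i j, continuous (fun x => f x i j)) -> continuous f.
Proof.
move=> cf x A [P fxP sPA]; rewrite /nbhs /=.
have : \forall z \near x, forall ij : 'I_m * 'I_n,
    P ij.1 ij.2 (f z ij.1 ij.2).
  by apply: filter_forall => -[i j] /=; apply: cf; exact: fxP.
apply: filterS => z Pz; apply: sPA => i j; exact: (Pz (i, j)).
Qed.

Lemma continuous_map_pair (X Y : topologicalType) (f : X -> Y) :
  continuous f -> continuous (fun p : X * X => (f p.1, f p.2)).
Proof.
move=> cf p.
have F1 := nbhs_filter (f p.1); have F2 := nbhs_filter (f p.2). 
apply: (cvg_pair (G := nbhs (f p.1)) (H := nbhs (f p.2))).
- by apply: (@continuous_comp _ _ _ fst f); [exact: cvg_fst|exact: cf].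
- by apply: (@continuous_comp _ _ _ snd f); [exact: cvg_snd|exact: cf].
Qed.

Lemma mulmx_continuous (K : numFieldType) (n : nat) :
  continuous (fun p : 'M[K]_n * 'M[K]_n => p.1 *m p.2).
Proof.
apply: continuous_mx => i j.
rewrite (_ : (fun _ => _) =
  (fun p : 'M[K]_n * 'M[K]_n => \sum_k p.1 i k * p.2 k j)); last first.
  by apply/funext => p; rewrite mxE.
apply: continuous_big => [|k _ p]; first exact: add_continuous.
apply: (@cvgM K _ _ _ (fun p : 'M[K]_n * 'M[K]_n => p.1 i k)
  (fun p : 'M[K]_n * 'M[K]_n => p.2 k j)).
- apply: (@continuous_comp _ _ _ fst (fun M : 'M[K]_n => M i k));
    [exact: cvg_fst|exact: coord_continuous].
- apply: (@continuous_comp _ _ _ snd (fun M : 'M[K]_n => M k j));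
    [exact: cvg_snd|exact: coord_continuous].
Qed.

Lemma trmx_continuous (K : numFieldType) (n : nat) :
  continuous (fun A : 'M[K]_n => A^T).
Proof.
apply: continuous_mx => i j.
rewrite (_ : (fun _ => _) = (fun A : 'M[K]_n => A j i)); last first.
  by apply/funext => A; rewrite mxE.
exact: coord_continuous.
Qed.

Lemma conjC_continuous (C : numClosedFieldType) :
  continuous (@Num.conj C : C -> C).
Proof.
move=> x A /nbhs_ballP [e /= e0 sA]; apply/nbhs_ballP; exists e => //= y.
rewrite -ball_normE /= => xy; apply: sA.
by rewrite -ball_normE /= -rmorphB norm_conjC.
Qed.

Lemma trmxC_continuous (C : numClosedFieldType) (n : nat) :
  continuous (fun A : 'M[C]_n => A ^t*%sesqui).
Proof.
apply: continuous_mx => i j.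
rewrite (_ : (fun _ => _) = (@Num.conj C) \o (fun A : 'M[C]_n => A j i)); last first.
  by apply/funext => A; rewrite /= !mxE.
move=> A; apply: continuous_comp; first exact: coord_continuous.
exact: conjC_continuous.
Qed.

End MatrixContinuity.

Section SpecialOrthogonal.
Variables (R : realType) (n : nat).

Definition SO_set : set 'M[R]_n := [set A | A *m A^T = 1%:M /\ \det A = 1].
Definition SO : Type := set_type SO_set.
HB.instance Definition _ := SubChoice.copy SO (set_type SO_set).
HB.instance Definition _ := Topological.copy SO (set_type SO_set).

Fact SO_one_subproof : 1%:M \in SO_set.
Proof. by apply/mem_set; rewrite /SO_set /= trmx1 mulmx1 det1. Qed.

Fact SO_mul_subproof (A B : SO) : val A *m val B \in SO_set.
Proof.
apply/mem_set; have [A1 dA] := set_valP A; have [B1 dB] := set_valP B.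
split; last by rewrite det_mulmx dA dB mulr1.
by rewrite trmx_mul mulmxA -(mulmxA (val A)) B1 mulmx1.
Qed.

Fact SO_inv_subproof (A : SO) : (val A)^T \in SO_set.
Proof.
apply/mem_set; have [A1 dA] := set_valP A.
by split; [rewrite trmxK; exact: mulmx1C|rewrite det_tr].
Qed.

Definition SO_one : SO := exist (fun M => M \in SO_set) _ SO_one_subproof.
Definition SO_mul (A B : SO) : SO := exist (fun M => M \in SO_set) _ (SO_mul_subproof A B).
Definition SO_inv (A : SO) : SO := exist (fun M => M \in SO_set) _ (SO_inv_subproof A).

Fact SO_mulA : associative SO_mul.
Proof. by move=> A B D; apply: val_inj; rewrite /= mulmxA. Qed.
Fact SO_mul1 : left_id SO_one SO_mul.
Proof. by move=> A; apply: val_inj; rewrite /= mul1mx. Qed.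
Fact SO_mulr1 : right_id SO_one SO_mul.
Proof. by move=> A; apply: val_inj; rewrite /= mulmx1. Qed.
Fact SO_mulrV : right_inverse SO_one SO_inv SO_mul.
Proof. by move=> A; apply: val_inj; have [] := set_valP A. Qed.
Fact SO_mulV : left_inverse SO_one SO_inv SO_mul.
Proof. by move=> A; apply: val_inj; have [/mulmx1C] := set_valP A. Qed.

HB.instance Definition _ := isGroup.Build SO
  SO_mulA SO_mul1 SO_mulr1 SO_mulV SO_mulrV.

Let val_continuous : continuous (val : SO -> 'M[R]_n).
Proof. exact: initial_continuous. Qed.

Fact SO_mul_continuous : continuous (fun p : SO * SO => (p.1 * p.2)%g).
Proof.
apply: (@continuous_comp_initial _ _ _ (val : SO -> 'M[R]_n)).
move=> p; apply: (@continuous_comp _ _ _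
  (fun p : SO * SO => (val p.1, val p.2)) (fun q => q.1 *m q.2)).
  by apply: continuous_map_pair; exact: val_continuous.
exact: mulmx_continuous.
Qed.

Fact SO_inv_continuous : continuous (fun A : SO => (A^-1)%g).
Proof.
apply: (@continuous_comp_initial _ _ _ (val : SO -> 'M[R]_n)).
rewrite -[_ \o _]/((fun M : 'M[R]_n => M^T) \o (val : SO -> 'M[R]_n)) => A.
apply: continuous_comp; first exact: val_continuous.
exact: trmx_continuous.
Qed.

HB.instance Definition _ := GroupTopological_isTopologicalGroup.Build SO
  SO_mul_continuous SO_inv_continuous.

End SpecialOrthogonal.

Arguments SO_set : clear implicits.

Section SpecialUnitary.
Variables (C : numClosedFieldType) (n : nat).

Definition SU_set : set 'M[C]_n := [set A | A \is unitarymx /\ \det A = 1].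
Definition SU : Type := set_type SU_set.
HB.instance Definition _ := SubChoice.copy SU (set_type SU_set).
HB.instance Definition _ := Topological.copy SU (set_type SU_set).

Fact SU_one_subproof : 1%:M \in SU_set.
Proof.
apply/mem_set; split; last exact: det1.
by apply/unitarymxP; rewrite trmx1 map_mx1 mulmx1.
Qed.

Fact SU_mul_subproof (A B : SU) : val A *m val B \in SU_set.
Proof.
apply/mem_set; have [A1 dA] := set_valP A; have [B1 dB] := set_valP B.
by split; [exact: mul_unitarymx|rewrite det_mulmx dA dB mulr1].
Qed.

Fact SU_inv_subproof (A : SU) : (val A)^t*%sesqui \in SU_set.
Proof.
apply/mem_set; have [A1 dA] := set_valP A.
by split; [rewrite trmxC_unitary|rewrite det_map_mx det_tr dA rmorph1].
Qed.

Definition SU_one : SU := exist (fun M => M \in SU_set) _ SU_one_subproof.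
Definition SU_mul (A B : SU) : SU := exist (fun M => M \in SU_set) _ (SU_mul_subproof A B).
Definition SU_inv (A : SU) : SU := exist (fun M => M \in SU_set) _ (SU_inv_subproof A).

Fact SU_mulA : associative SU_mul.
Proof. by move=> A B D; apply: val_inj; rewrite /= mulmxA. Qed.
Fact SU_mul1 : left_id SU_one SU_mul.
Proof. by move=> A; apply: val_inj; rewrite /= mul1mx. Qed.
Fact SU_mulr1 : right_id SU_one SU_mul.
Proof. by move=> A; apply: val_inj; rewrite /= mulmx1. Qed.
Fact SU_mulrV : right_inverse SU_one SU_inv SU_mul.
Proof. by move=> A; apply: val_inj; have [/unitarymxP] := set_valP A. Qed.
Fact SU_mulV : left_inverse SU_one SU_inv SU_mul.
Proof. by move=> A; apply: val_inj; have [/unitarymxP/mulmx1C] := set_valP A. Qed.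

HB.instance Definition _ := isGroup.Build SU
  SU_mulA SU_mul1 SU_mulr1 SU_mulV SU_mulrV.

Let val_continuous : continuous (val : SU -> 'M[C]_n).
Proof. exact: initial_continuous. Qed.

Fact SU_mul_continuous : continuous (fun p : SU * SU => (p.1 * p.2)%g).
Proof.
apply: (@continuous_comp_initial _ _ _ (val : SU -> 'M[C]_n)).
move=> p; apply: (@continuous_comp _ _ _
  (fun p : SU * SU => (val p.1, val p.2)) (fun q => q.1 *m q.2)).
  by apply: continuous_map_pair; exact: val_continuous.
exact: mulmx_continuous.
Qed.

Fact SU_inv_continuous : continuous (fun A : SU => (A^-1)%g).
Proof.
apply: (@continuous_comp_initial _ _ _ (val : SU -> 'M[C]_n)).
rewrite -[_ \o _]/((fun M : 'M[C]_n => M ^t*%sesqui) \o (val : SU -> 'M[C]_n)) => A.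
apply: continuous_comp; first exact: val_continuous.
exact: trmxC_continuous.
Qed.

HB.instance Definition _ := GroupTopological_isTopologicalGroup.Build SU
  SU_mul_continuous SU_inv_continuous.

End SpecialUnitary.

Arguments SU_set : clear implicits.

Section Mu4Q8.
Variable C : numClosedFieldType.

Definition mx22 (a b c d : C) : 'M[C]_2 :=
  \matrix_(i < 2, j < 2)
    if i == 0 then if j == 0 then a else b else if j == 0 then c else d.

Let mx22_mul a b c d a' b' c' d' :
  mx22 a b c d *m mx22 a' b' c' d' =
  mx22 (a * a' + b * c') (a * b' + b * d') (c * a' + d * c') (c * b' + d * d').
Proof.
apply/matrixP => i j; rewrite !mxE big_ord_recl big_ord1 !mxE /=.
by case: (i == 0); case: (j == 0).
Qed.

Let mx22_1 : mx22 1 0 0 1 = 1%:M.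
Proof.
by apply/matrixP => -[[|[|//]] Hi] [[|[|//]] Hj]; rewrite !mxE.
Qed.

Let mx22_trC a b c d : ((mx22 a b c d) ^t*)%sesqui = mx22 a^* c^* b^* d^*.
Proof.
apply/matrixP => i j; rewrite !mxE.
by case: (i == 0); case: (j == 0).
Qed.

Let mx22_det a b c d : \det (mx22 a b c d) = a * d - b * c.
Proof.
rewrite (expand_det_row _ 0) big_ord_recl big_ord1 /cofactor !det_mx11 !mxE /=.
by rewrite expr0 expr1 mul1r mulN1r mulrN.
Qed.

Fact mu4_gen_subproof : mx22 'i 0 0 (- 'i) \in SU_set C 2.
Proof.
apply/mem_set; split; last by rewrite mx22_det mulr0 subr0 mulrN -expr2 sqrCi opprK.
apply/unitarymxP; rewrite mx22_trC mx22_mul -mx22_1.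
rewrite !rmorphN !rmorph0 /= conjCi opprK !(mulr0, mul0r, addr0, add0r).
by rewrite mulrN mulNr -expr2 sqrCi opprK.
Qed.

Fact Q8_gen_subproof : mx22 0 (- 1) 1 0 \in SU_set C 2.
Proof.
apply/mem_set; split; last by rewrite mx22_det mulr0 add0r mulr1 opprK.
apply/unitarymxP; rewrite mx22_trC mx22_mul -mx22_1.
rewrite !rmorphN !rmorph0 /= rmorph1 !(mulr0, mul0r, addr0, add0r).
by rewrite mulrNN !mulr1.
Qed.

Definition mu4_gen : SU C 2 := exist (fun M => M \in SU_set C 2) _ mu4_gen_subproof.
Definition Q8_gen : SU C 2 := exist (fun M => M \in SU_set C 2) _ Q8_gen_subproof.

Definition mu4_set : set (SU C 2) := generated_subgroup [set mu4_gen].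
Definition mu4 : {pred SU C 2} := [in mu4_set].

HB.instance Definition _ :=
  isGroupClosed.Build (SU C 2) mu4 (generated_subgroup_closed [set mu4_gen]).

Definition Q8_set : set (SU C 2) :=
  mu4_set `|` [set (Q8_gen * x)%g | x in mu4_set].
Definition Q8 : {pred SU C 2} := [in Q8_set].

Let u := mu4_gen.
Let w := Q8_gen.

Let ww : (w * w = u * u)%g.
Proof.
apply: val_inj; rewrite /= !mx22_mul !(mulr0, mul0r, addr0, add0r) mulrNN.
by rewrite -expr2 sqrCi mulr1 mul1r.
Qed.

Let uw : (u * w = w * u^-1)%g.
Proof.
apply: val_inj; rewrite /= mx22_trC !mx22_mul.
rewrite !rmorphN !rmorph0 /= conjCi opprK !(mulr0, mul0r, addr0, add0r).
by rewrite mulr1 mul1r mulrN1 mulN1r.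
Qed.

Let mu4F x y : mu4_set x -> mu4_set y -> mu4_set (x / y)%g.
Proof.
have /group_closedE[_] := generated_subgroup_closed [set mu4_gen]; exact.
Qed.

Let mu4_1 : mu4_set 1%g.
Proof. by have /group_closedE[] := generated_subgroup_closed [set mu4_gen]. Qed.

Let mu4V x : mu4_set x -> mu4_set (x^-1)%g.
Proof. by move=> mx; rewrite -[(x^-1)%g]mul1g; exact: mu4F. Qed.

Let mu4M x y : mu4_set x -> mu4_set y -> mu4_set (x * y)%g.
Proof. by move=> mx /mu4V my; rewrite -[y]invgK; exact: mu4F. Qed.

Let mu4u : mu4_set u. Proof. exact: sub_gen_smallest. Qed.

Let mu4J x : mu4_set x -> mu4_set (x ^ w)%g.
Proof.
apply: (@smallest_sub _ _ _ [set x | mu4_set (x ^ w)%g]); last first.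
  move=> _ -> /=; rewrite /conjg uw mulKg; exact: mu4V.
apply/group_closedE; split=> [|a b] /=; first by rewrite conj1g.
by rewrite conjMg conjVg; exact: mu4F.
Qed.

Fact Q8_closed : group_closed Q8.
Proof.
have mw2 : mu4_set (w * w)%g by rewrite ww; exact: mu4M.
apply/group_closedE; split; first by left.
move=> x' y' [mx|[x mx <-]] [my|[y my <-]].
- by left; exact: mu4F.
- right; exists ((x' / y) ^ w / (w * w))%g.
    by apply: mu4F => //; apply: mu4J; exact: mu4F.
  by rewrite -/w /conjg !invgM !mulgA mulgV mul1g mulgK.
- by right; exists (x / y')%g; rewrite ?mulgA//; exact: mu4F.
- left; rewrite invgM -/w.
  have -> : (w * x * (y^-1 * w^-1) = ((w * w) * (x / y)^w) / (w * w))%g.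
    by rewrite /conjg !invgM !mulgA mulgK mulgK.
  by apply: mu4F => //; apply: mu4M => //; apply: mu4J; exact: mu4F.
Qed.

HB.instance Definition _ := isGroupClosed.Build (SU C 2) Q8 Q8_closed.

End Mu4Q8.

(* Z^n written multiplicatively. *)
Definition Zn (n : nat) : groupType := Algebra.to_multiplicative 'rV[int]_n.

(* The quotient F_n / Gamma^q_n. *)
Definition free_nilpotent (n q : nat) : groupType :=
  quotient_group (lower_central_pred (free_group n) q).

(* One of the two factors is divisible by 3, so the division is exact. *)
Definition nb_Q8 (n : nat) : nat := ((2 ^ n - 1) * (2 ^ (n - 1) - 1) %/ 3)%N.

Definition nb_mu4 (n q : nat) : nat :=
  ((2 ^ n - 1) * (2 ^ ((q - 2) * (n - 1)) - 1) * 2 ^ (n - 2))%N.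

(* Sigma types carry the disjoint union topology. *)
Definition disjoint_sum (X Y : topologicalType) : topologicalType :=
  {b : bool & if b then X else Y}.

Definition copies (k : nat) (X : topologicalType) : topologicalType :=
  {i : 'I_k & X}.

(* Main.v *)
Require Import Defs.
From HB Require Import structures.
From mathcomp Require Import all_boot all_order all_algebra.
From mathcomp Require Import generic_quotient spectral complex.
From mathcomp Require Import all_classical all_reals all_analysis.
From mathcomp Require Import ring lra.

(** The image of a homomorphism F_n/Gamma^q -> SO(3) is nilpotent.  If it is not
contained in a maximal torus, the last nontrivial term of its central series
contains a central rotation, so the image preserves an axis; after conjugation
it lies in O(2), and iterated commutators with a half-turn show that its
rotations have order dividing 2^(q-1).  Hence it is dihedral, and the
homomorphism is conjugate to one given by a vector of signs and a vector of
elements of Z/2^(q-1).  The stabiliser in SU(2) of such a normal form is Q_8 if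
the image is the Klein group, and a copy of mu_4 otherwise; two Klein normal
forms are conjugate iff they span the same plane of (Z/2)^n (classes of size 6),
two others iff they differ by the sign of the angles (classes of size 2), which
gives M(n) and M(n,q).  The toral homomorphisms factor through Z^n and form the
component of 1 there: a path shrinks the angles to 0, while
tr g(x) + tr g(y) + tr g(xy) is nonnegative on toral homomorphisms and lies in
{-3, 1, 5, 9} on the other abelian ones, so it separates the two.  All the
pieces are compact and the space of homomorphisms is Hausdorff, so the resulting
continuous bijection is a homeomorphism. *)

Set Implicit Arguments.
Unset Strict Implicit.
Unset Printing Implicit Defensive.

Import Order.TTheory GRing.Theory Num.Theory.
Import numFieldNormedType.Exports.

Local Open Scope quotient_scope.
Local Open Scope classical_set_scope.
Local Open Scope ring_scope.

(** * Free groups and free nilpotent groups *)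

(** The two families come from the axis. A rotation of order greater than two determines its axis,
    so an image containing one can be moved only inside O(2), whereas the three axes of a Klein
    group are permuted by rotations. Inside O(2), conjugation by a rotation of angle a shifts the
    angle of every reversing element by 2a, up to sign. Sending one reversing generator to [flip]
    uses up this freedom, except for the rotation by pi, which changes nothing, and for [flip],
    which negates all angles. The constants: put p = q - 1. Each of the 2^n - 1 nonzero sign vectors
    comes with 2^(p(n-1)) - 2^(n-1) angle vectors that vanish at the first reversing generator and
    are not killed by 2; pairing opposite vectors gives M(n,q). There are (2^n - 1)(2^n - 2) ordered
    pairs of independent sign vectors, and a plane over F_2 has six ordered bases, which gives M(n).
    All conjugations are by SU(2) through the double cover, so that orbits are coset spaces of SU(2)
    itself; the kernel of the cover lies in every stabiliser, hence the orders 4 and 8 instead of 2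
    and 4. *)

Section Morphisms.
Local Open Scope group_scope.
Variables (G K : groupType) (f : G -> K).
Hypothesis fM : {morph f : x y / x * y}.

Lemma morph1g : f 1 = 1.
Proof. by apply: (mulgI (f 1)); rewrite -fM !mulg1. Qed.

Lemma morphVg x : f x^-1 = (f x)^-1.
Proof. by apply: (mulgI (f x)); rewrite -fM !mulgV morph1g. Qed.

Lemma morphRg x y : f [~ x, y] = [~ f x, f y].
Proof. by rewrite /commg /conjg !fM !morphVg. Qed.

End Morphisms.

Section FreeGroupMorphisms.
Local Open Scope group_scope.
Variable n : nat.
Local Notation F := (free_group n).

Definition free_gen (i : 'I_n) : F := @FreeGroup n [:: (i, false)] isT.

Lemma reduced_behead a w : @reduced n (a :: w) -> reduced w.
Proof. exact: path_sorted. Qed.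

(** Left multiplication by 1 reduces the word of its argument, so the group law already contains
    this. *)
Lemma reduce_reduced_id w : reduced w -> @reduce n w = w.
Proof. by move=> rw; have /(congr1 val) := mul1g (FreeGroup rw : F). Qed.

Lemma free_group_ind (P : F -> Prop) : P 1 ->
  (forall i x, P x -> P (free_gen i * x)) ->
  (forall i x, P x -> P ((free_gen i)^-1 * x)) -> forall x, P x.
Proof.
move=> P1 Pg Pv [w rw]; elim: w rw => [|[i b] w IHw] rw.
  by rewrite (_ : FreeGroup _ = 1) //; exact: val_inj.
have rw' := reduced_behead rw.
pose g := if b then (free_gen i)^-1 else free_gen i.
(* No cancellation occurs at the front, because the whole word is reduced. *)
have -> : FreeGroup rw = g * FreeGroup rw'.
  apply: val_inj; rewrite /= -[LHS]reduce_reduced_id //.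
  by rewrite /g; case: b {g rw} => /=.
by rewrite /g; case: (b); [apply: Pv|apply: Pg].
Qed.

Section Eval.
Variables (K : groupType) (g : 'I_n -> K).

Definition letter_eval (a : letter n) : K := if a.2 then (g a.1)^-1 else g a.1.
Definition word_eval (w : seq (letter n)) : K :=
  foldr (fun a x => letter_eval a * x) 1 w.
Definition free_eval (x : F) : K := word_eval (word_of x).

Lemma letter_evalV a : letter_eval (letter_inv a) = (letter_eval a)^-1.
Proof. by case: a => i [] /=; rewrite /letter_eval /= ?invgK. Qed.

Lemma word_eval_cat u v : word_eval (u ++ v) = word_eval u * word_eval v.
Proof. by elim: u => [|a u IHu] /=; rewrite ?mul1g // IHu mulgA. Qed.

Lemma word_eval_reduce w : word_eval (reduce w) = word_eval w.
Proof.
elim: w => [//|a w]; rewrite /reduce /=; case: (foldr _ _ w) => [|b u] /= <- //.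
case: eqP => [->|//]; by rewrite letter_evalV mulVKg.
Qed.

Lemma free_evalM : {morph free_eval : x y / x * y}.
Proof. by move=> x y; rewrite /free_eval /= word_eval_reduce word_eval_cat. Qed.

Lemma free_eval_gen i : free_eval (free_gen i) = g i.
Proof. exact: mulg1. Qed.

End Eval.

Lemma free_group_gen_ind (P : F -> Prop) : P 1 ->
  (forall x y, P x -> P y -> P (x / y)) -> (forall i, P (free_gen i)) ->
  forall x, P x.
Proof.
move=> P1 PM Pg; have PV x : P x -> P x^-1.
  by move=> Px; rewrite -[x^-1]mul1g; exact: PM.
apply: free_group_ind => // i x Px.
  by rewrite -[x]invgK; apply: PM => //; apply: PV.
by rewrite -[x]invgK; apply: PM; apply: PV.
Qed.

End FreeGroupMorphisms.

Section LowerCentral.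
Local Open Scope group_scope.
Variable G : groupType.

(** Minimality of the lower central series among central filtrations. To show that a homomorphism
    kills Gamma^q, one exhibits such an [H] whose q-th term is killed. *)
Lemma lower_central_sub (H : nat -> set G) :
  (forall x, H 1%N x) ->
  (forall k, group_closed [in H k.+1]) ->
  (forall k x y, H k.+1 x -> H k.+2 [~ x, y]) ->
  forall k x, lower_central G k.+1 x -> H k.+1 x.
Proof.
move=> H1 Hc HR; elim=> [//|k IHk] x.
apply: (@smallest_sub _ _ _ (H k.+2)); first exact: Hc.
by move=> _ [a /IHk Ha [b _ <-]]; exact: HR.
Qed.

Lemma lower_central_comm k (x y : G) :
  lower_central G k.+1 x -> lower_central G k.+2 [~ x, y].
Proof.
by move=> xk; apply: sub_gen_smallest; exists x => //; exists y.
Qed.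

End LowerCentral.

Section FreeNilpotent.
Local Open Scope group_scope.
Variables n q : nat.
Local Notation F := (free_group n).
Local Notation Q := (free_nilpotent n q).

Definition nil_pi (x : F) : Q := \pi_Q x.

Lemma nil_piM : {morph nil_pi : x y / x * y}.
Proof. by move=> x y; rewrite /nil_pi -quotient_mulE. Qed.

Lemma nil_pi_repr (c : Q) : nil_pi (repr c) = c.
Proof. exact: reprK. Qed.

Lemma nil_pi_eq1 (x : F) : lower_central F q x -> nil_pi x = 1.
Proof.
move=> xq; rewrite -(morph1g nil_piM) /nil_pi; apply/eqP.
rewrite eq_sym; apply/eqP; apply/(@eqquotP _ (coset_equiv _)).
by rewrite /= /coset_rel invg1 mul1g; apply/mem_set.
Qed.

Lemma nil_pi_eq (x y : F) : nil_pi x = nil_pi y -> lower_central F q (x^-1 * y).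
Proof.
by move=> /(@eqquotP _ (coset_equiv _)) xy; exact: set_mem xy.
Qed.

Definition nil_gen i : Q := nil_pi (free_gen i).

Lemma nil_gen_ind (P : Q -> Prop) : P 1 ->
  (forall x y, P x -> P y -> P (x / y)) -> (forall i, P (nil_gen i)) ->
  forall x, P x.
Proof.
move=> P1 PM Pg c; rewrite -(nil_pi_repr c); move: (repr c).
apply: (@free_group_gen_ind n (fun x => P (nil_pi x))) => //.
  by rewrite (morph1g nil_piM).
by move=> x y Px Py; rewrite nil_piM (morphVg nil_piM); exact: PM.
Qed.

Lemma nil_morph_ext (K : groupType) (f1 f2 : Q -> K) :
  {morph f1 : x y / x * y} -> {morph f2 : x y / x * y} ->
  (forall i, f1 (nil_gen i) = f2 (nil_gen i)) -> f1 = f2.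
Proof.
move=> f1M f2M f12; apply/funext; apply: (nil_gen_ind (P := fun x => f1 x = f2 x)) => //.
- by rewrite (morph1g f1M) (morph1g f2M).
- by move=> x y fx fy; rewrite f1M f2M (morphVg f1M) (morphVg f2M) fx fy.
Qed.

Section Eval.
Variables (K : groupType) (g : 'I_n -> K).
Hypothesis gq : forall x, lower_central F q x -> free_eval g x = 1.

Definition nil_eval (c : Q) : K := free_eval g (repr c).

(** Independence of the representative: [repr] changes [x] by an element of Gamma^q, which [gq]
    sends to 1. *)
Lemma nil_eval_pi x : nil_eval (nil_pi x) = free_eval g x.
Proof.
have /nil_pi_eq/gq := nil_pi_repr (nil_pi x).
rewrite free_evalM (morphVg (free_evalM g)) => e.
by apply: (mulgI (free_eval g (repr (nil_pi x)))^-1); rewrite e mulVg.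
Qed.

Lemma nil_evalM : {morph nil_eval : x y / x * y}.
Proof.
move=> x y; rewrite -[x]nil_pi_repr -[y]nil_pi_repr -nil_piM !nil_eval_pi.
exact: free_evalM.
Qed.

Lemma nil_eval_gen i : nil_eval (nil_gen i) = g i.
Proof. by rewrite nil_eval_pi free_eval_gen. Qed.

End Eval.
End FreeNilpotent.

(** * Rotations and the double cover *)

Section Matrix3.
Variable R : comNzRingType.

Definition mx33 (a b c d e f g h i : R) : 'M[R]_3 :=
  \matrix_(k < 3, l < 3) nth 0 (nth [::] [:: [:: a; b; c]; [:: d; e; f]; [:: g; h; i]] k) l.

Lemma mx33_eta (A : 'M[R]_3) : A = mx33 (A 0 0) (A 0 1) (A 0 2) (A 1 0)
  (A 1 1) (A 1 2) (A 2 0) (A 2 1) (A 2 2).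
Proof.
apply/matrixP => -[[|[|[|//]]] Hi] [[|[|[|//]]] Hj]; rewrite !mxE /=;
  by congr (A _ _); exact: val_inj.
Qed.

Lemma mx33_mul a b c d e f g h i a' b' c' d' e' f' g' h' i' :
  mx33 a b c d e f g h i *m mx33 a' b' c' d' e' f' g' h' i' =
  mx33 (a * a' + b * d' + c * g') (a * b' + b * e' + c * h')
       (a * c' + b * f' + c * i')
       (d * a' + e * d' + f * g') (d * b' + e * e' + f * h')
       (d * c' + e * f' + f * i')
       (g * a' + h * d' + i * g') (g * b' + h * e' + i * h')
       (g * c' + h * f' + i * i').
Proof.
apply/matrixP => -[[|[|[|//]]] Hi] [[|[|[|//]]] Hj];
by rewrite !mxE !big_ord_recl big_ord0 addr0 !mxE /= ?addrA.
Qed.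

Lemma mx33_tr a b c d e f g h i :
  (mx33 a b c d e f g h i)^T = mx33 a d g b e h c f i.
Proof. by apply/matrixP => -[[|[|[|//]]] Hi] [[|[|[|//]]] Hj]; rewrite !mxE. Qed.

Lemma mx33_1 : 1%:M = mx33 1 0 0 0 1 0 0 0 1.
Proof. by apply/matrixP => -[[|[|[|//]]] Hi] [[|[|[|//]]] Hj]; rewrite !mxE. Qed.

Lemma mx33_det a b c d e f g h i :
  \det (mx33 a b c d e f g h i) =
  a * (e * i - f * h) - b * (d * i - f * g) + c * (d * h - e * g).
Proof.
rewrite (expand_det_row _ 0) !big_ord_recl big_ord0 /cofactor.
do 3! rewrite (expand_det_row _ 0) !big_ord_recl big_ord0 /cofactor !det_mx11.
rewrite !mxE /=. rewrite /bump /=. ring.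
Qed.

Lemma mx33_trace a b c d e f g h i : \tr (mx33 a b c d e f g h i) = a + e + i.
Proof. by rewrite /mxtrace !big_ord_recl big_ord0 !mxE /= addr0 addrA. Qed.

Lemma mx33_inj a b c d e f g h i a' b' c' d' e' f' g' h' i' :
  mx33 a b c d e f g h i = mx33 a' b' c' d' e' f' g' h' i' ->
  [/\ [/\ a = a', b = b' & c = c'], [/\ d = d', e = e' & f = f']
    & [/\ g = g', h = h' & i = i']].
Proof.
move=> /matrixP E; split; split.
- by have := E 0 0; rewrite !mxE.
- by have := E 0 1; rewrite !mxE.
- by have := E 0 2; rewrite !mxE.
- by have := E 1 0; rewrite !mxE.
- by have := E 1 1; rewrite !mxE.
- by have := E 1 2; rewrite !mxE.
- by have := E 2 0; rewrite !mxE.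
- by have := E 2 1; rewrite !mxE.
- by have := E 2 2; rewrite !mxE.
Qed.

End Matrix3.

(** * Unit quaternions, the map SU(2) -> SO(3), and rotations about the first axis *)

Section DoubleCover.
Variable R : realType.
Local Notation C := R[i].
Local Notation K := (SU C 2).
Local Notation G := (SO R 3).

(* The quaternion a + bi + cj + dk, with i = [mu4_gen] and j = [Q8_gen]; the sign
of d makes the matrix product agree with the quaternion product. *)
Definition qmx (a b c d : R) : 'M[C]_2 :=
  mx22 (a +i* b)%C (- c -i* d)%C (c -i* d)%C (a -i* b)%C.

(** The matrix of v |-> u v u^-1 on imaginary quaternions, for u = a + bi + cj + dk of norm 1. *)
Definition qrot (a b c d : R) : 'M[R]_3 :=
  mx33 (a ^+ 2 + b ^+ 2 - c ^+ 2 - d ^+ 2) (2 * (b * c - a * d)) (2 * (b * d + a * c))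
    (2 * (b * c + a * d)) (a ^+ 2 - b ^+ 2 + c ^+ 2 - d ^+ 2) (2 * (c * d - a * b))
    (2 * (b * d - a * c)) (2 * (c * d + a * b)) (a ^+ 2 - b ^+ 2 - c ^+ 2 + d ^+ 2).

Lemma mx22_eta (A : 'M[C]_2) : A = mx22 (A 0 0) (A 0 1) (A 1 0) (A 1 1).
Proof.
apply/matrixP => -[[|[|//]] Hi] [[|[|//]] Hj]; rewrite !mxE /=;
  by congr (A _ _); exact: val_inj.
Qed.

Lemma mx22_mul (a b c d a' b' c' d' : C) :
  mx22 a b c d *m mx22 a' b' c' d' =
  mx22 (a * a' + b * c') (a * b' + b * d') (c * a' + d * c') (c * b' + d * d').
Proof.
apply/matrixP => i j; rewrite !mxE big_ord_recl big_ord1 !mxE /=.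
by case: (i == 0); case: (j == 0).
Qed.

Lemma mx22_1 : 1%:M = mx22 1 0 0 1 :> 'M[C]_2.
Proof. by apply/matrixP => -[[|[|//]] Hi] [[|[|//]] Hj]; rewrite !mxE. Qed.

Lemma mx22_trC (a b c d : C) : ((mx22 a b c d) ^t*)%sesqui = mx22 a^* c^* b^* d^*.
Proof.
by apply/matrixP => i j; rewrite !mxE; case: (i == 0); case: (j == 0).
Qed.

Lemma mx22_det (a b c d : C) : \det (mx22 a b c d) = a * d - b * c.
Proof.
rewrite (expand_det_row _ 0) big_ord_recl big_ord1 /cofactor !det_mx11 !mxE /=.
by rewrite expr0 expr1 mul1r mulN1r mulrN.
Qed.

Lemma mx22_inj (a b c d a' b' c' d' : C) : mx22 a b c d = mx22 a' b' c' d' ->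
  [/\ a = a', b = b', c = c' & d = d'].
Proof.
move=> /matrixP E; split.
- by have := E 0 0; rewrite !mxE.
- by have := E 0 1; rewrite !mxE.
- by have := E 1 0; rewrite !mxE.
- by have := E 1 1; rewrite !mxE.
Qed.

Lemma qmx_SU (a b c d : R) : a ^+ 2 + b ^+ 2 + c ^+ 2 + d ^+ 2 = 1 ->
  qmx a b c d \in SU_set C 2.
Proof.
move=> h; apply/mem_set; split; last first.
  by rewrite mx22_det; apply/eqP; rewrite eq_complex /=; apply/andP; split;
    apply/eqP; rewrite -?h; ring.
apply/unitarymxP; rewrite mx22_trC mx22_mul mx22_1.
by congr mx22; apply/eqP; rewrite eq_complex /=; apply/andP; split;
  apply/eqP; rewrite -?h; ring.
Qed.

Lemma SU_qmx (U : K) : exists a b c d : R,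
  a ^+ 2 + b ^+ 2 + c ^+ 2 + d ^+ 2 = 1 /\ val U = qmx a b c d.
Proof.
have [/unitarymxP U1 dU] := set_valP U.
move: U1 dU; rewrite /= -/(val U); set A := val U.
move=> A1; have A2 := mulmx1C A1; move: A1 A2.
rewrite (mx22_eta A) mx22_trC !mx22_mul mx22_det mx22_1.
move: (A 0 0) (A 0 1) (A 1 0) (A 1 1) => x y z w.
move=> /mx22_inj[x1 xz _ _] /mx22_inj[x2 xy _ _] d1.
(* Writing 1 as the squared norm of the first column, orthogonality of the columns and determinant 1
   express the second column through the first. *)
have ew : w = x^*.
  transitivity ((x^* * x + z^* * z) * w); first by rewrite x2 mul1r.
  transitivity (x^* * (x * w - y * z) + z * (x^* * y + z^* * w)); first by ring.
  by rewrite d1 xy mulr0 addr0 mulr1.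
have ey : y = - z^*.
  transitivity ((x^* * x + z^* * z) * y); first by rewrite x2 mul1r.
  transitivity (- z^* * (x * w - y * z) + x * (x^* * y + z^* * w)); first by ring.
  by rewrite d1 xy mulr0 addr0 mulr1.
rewrite {}ew {}ey in d1 *; case: x z d1 {x1 xz x2 xy} => [a b] [c d] /eqP.
rewrite eq_complex /= => /andP[/eqP d1 _].
exists a, b, c, (- d); split; first by rewrite -d1; ring.
rewrite /qmx opprK; congr mx22; apply/eqP; rewrite eq_complex /=; apply/andP; split;
  by apply/eqP; ring.
Qed.

Lemma qrot_SO (a b c d : R) : a ^+ 2 + b ^+ 2 + c ^+ 2 + d ^+ 2 = 1 ->
  qrot a b c d \in SO_set R 3.
Proof.
move=> h; apply/mem_set; split; last first.
  rewrite /qrot mx33_det.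
  by transitivity ((a ^+ 2 + b ^+ 2 + c ^+ 2 + d ^+ 2) ^+ 3); [ring|rewrite h expr1n].
rewrite /qrot mx33_tr mx33_mul mx33_1.
congr mx33; first [ring |
  by transitivity ((a ^+ 2 + b ^+ 2 + c ^+ 2 + d ^+ 2) ^+ 2); [ring|rewrite h expr1n]].
Qed.

(** The quaternion is read off the first column, so the entries are polynomials in real and
    imaginary parts; continuity of [rho] follows from this form. *)
Definition rho_mx (U : 'M[C]_2) : 'M[R]_3 :=
  qrot (complex.Re (U 0 0)) (complex.Im (U 0 0)) (complex.Re (U 1 0)) (- complex.Im (U 1 0)).

Lemma rho_mx_qmx a b c d : rho_mx (qmx a b c d) = qrot a b c d.
Proof. by rewrite /rho_mx !mxE /= opprK. Qed.

Fact rho_subproof (U : K) : rho_mx (val U) \in SO_set R 3.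
Proof. by have [a [b [c [d [h ->]]]]] := SU_qmx U; rewrite rho_mx_qmx qrot_SO. Qed.

Definition rho (U : K) : G := exist (fun M => M \in SO_set R 3) _ (rho_subproof U).

Lemma rhoM : {morph rho : U V / (U * V)%g}.
Proof.
move=> U V; apply: val_inj; rewrite /=.
have [a [b [c [d [_ ->]]]]] := SU_qmx U.
have [a' [b' [c' [d' [_ ->]]]]] := SU_qmx V.
rewrite !rho_mx_qmx /qmx mx22_mul /rho_mx !mxE /= /qrot mx33_mul.
congr mx33; ring.
Qed.

Lemma rho_qrot (a b c d : R) : a ^+ 2 + b ^+ 2 + c ^+ 2 + d ^+ 2 = 1 ->
  exists U : K, val (rho U) = qrot a b c d.
Proof.
move=> h; exists (exist (fun M => M \in SU_set C 2) _ (qmx_SU h)).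
exact: rho_mx_qmx.
Qed.

Fact rotx_subproof (t : R) :
  mx33 1 0 0 0 (cos t) (- sin t) 0 (sin t) (cos t) \in SO_set R 3.
Proof.
have h := cos2Dsin2 t; apply/mem_set; split.
  by rewrite mx33_tr mx33_mul mx33_1; congr mx33; first [ring|rewrite -[RHS]h; ring].
by rewrite mx33_det -[RHS]h; ring.
Qed.

Definition rotx (t : R) : G := exist (fun M => M \in SO_set R 3) _ (rotx_subproof t).

Fact flip_subproof : mx33 (-1) 0 0 0 1 0 0 0 (-1) \in SO_set R 3.
Proof.
apply/mem_set; split; last by rewrite mx33_det; ring.
by rewrite mx33_tr mx33_mul mx33_1; congr mx33; ring.
Qed.

Definition flip : G := exist (fun M => M \in SO_set R 3) _ flip_subproof.

Lemma rotxD s t : rotx (s + t) = (rotx s * rotx t)%g.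
Proof.
apply: val_inj; rewrite /= mx33_mul cosD sinD; congr mx33; ring.
Qed.

Lemma rotx0 : rotx 0 = 1%g.
Proof. by apply: val_inj; rewrite /= cos0 sin0 oppr0 mx33_1. Qed.

Lemma rotxN t : rotx (- t) = ((rotx t)^-1)%g.
Proof. by apply: (mulgI (rotx t)); rewrite -rotxD subrr rotx0 mulgV. Qed.

Lemma rotxB s t : rotx (s - t) = (rotx s / rotx t)%g.
Proof. by rewrite rotxD rotxN. Qed.

Lemma rotxMn t n : rotx (t *+ n) = (rotx t ^+ n)%g.
Proof. by elim: n => [|n IHn]; rewrite ?rotx0// mulrS rotxD IHn expgS. Qed.

Lemma flip2 : (flip * flip = 1)%g.
Proof. by apply: val_inj; rewrite /= mx33_mul mx33_1; congr mx33; ring. Qed.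

Lemma flipV : (flip^-1 = flip)%g.
Proof. by apply: (mulgI flip); rewrite mulgV flip2. Qed.

Lemma flip_rotx t : (flip * rotx t = rotx (- t) * flip)%g.
Proof. by apply: val_inj; rewrite /= !mx33_mul cosN sinN; congr mx33; ring. Qed.

Lemma rotx_neq_flip s t : rotx s <> (rotx t * flip)%g.
Proof.
move=> /(congr1 val) /=; rewrite mx33_mul => /mx33_inj[[+ _ _] _ _].
lra.
Qed.

Lemma rotx_eq1 t : rotx t = 1%g <-> cos t = 1.
Proof.
split=> [/(congr1 val) /=|h]; first by rewrite mx33_1 => /mx33_inj[_ [_ ->]].
have s0 : sin t = 0 by apply: cos1sin0; rewrite h normr1.
by apply: val_inj; rewrite /= h s0 oppr0 mx33_1.
Qed.

Lemma SO3_orth (A : G) (i j : 'I_3) :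
  \sum_k val A i k * val A j k = (i == j)%:R /\
  \sum_k val A k i * val A k j = (i == j)%:R.
Proof.
have [A1 _] := set_valP A; have A2 := mulmx1C A1.
split; [have /matrixP/(_ i j) := A1|have /matrixP/(_ i j) := A2];
by rewrite !mxE => <-; apply: eq_bigr => k _; rewrite !mxE.
Qed.

Lemma big_ord3 (V : nmodType) (F : 'I_3 -> V) : \sum_k F k = F 0 + F 1 + F 2.
Proof.
rewrite !big_ord_recl big_ord0 addr0 addrA.
by congr (F _ + F _ + F _); exact: val_inj.
Qed.

Lemma circle_angle (c s : R) : c ^+ 2 + s ^+ 2 = 1 ->
  exists t, cos t = c /\ sin t = s.
Proof.
move=> h; have c1 : -1 <= c <= 1.
  by apply/andP; split; nra.
have ca : cos (acos c) = c by rewrite acosK// in_itv.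
have sa : sin (acos c) = `|s|.
  by rewrite sin_acos // -h addrC addKr sqrtr_sqr.
have [s0|s0] := lerP 0 s.
  by exists (acos c); rewrite sa ger0_norm.
by exists (- acos c); rewrite cosN sinN sa ltr0_norm// opprK.
Qed.

Lemma SO3_fix0 (A : G) : val A 0 0 = 1 -> exists t, A = rotx t.
Proof.
move=> h.
have [r0 c0] := SO3_orth A 0 0; have [r1 c1] := SO3_orth A 1 1.
have [r12 c12] := SO3_orth A 1 2; have [r2 c2] := SO3_orth A 2 2.
have [_] := set_valP A; rewrite /= -/(val A) [X in \det X]mx33_eta mx33_det h => dA.
move: r0 c0 r1 c1 r12 c12 r2 c2; rewrite !big_ord3 /= !h => r0 c0 r1 c1 r12 c12 r2 c2.
have a01 : val A 0 1 = 0 by nra.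
have a02 : val A 0 2 = 0 by nra.
have a10 : val A 1 0 = 0 by nra.
have a20 : val A 2 0 = 0 by nra.
rewrite a01 a02 a10 a20 in r0 c0 r1 c1 r12 c12 r2 c2 dA.
(* The left side equals 2 - 2 det of the lower right block, whose rows are orthonormal. *)
have h0 : (val A 1 1 - val A 2 2) ^+ 2 + (val A 1 2 + val A 2 1) ^+ 2 = 0 by nra.
move/eqP: h0; rewrite paddr_eq0 ?sqr_ge0 // !sqrf_eq0 subr_eq0 addr_eq0.
move=> /andP[/eqP e1 /eqP e2].
have [t [ct st]] : exists t, cos t = val A 1 1 /\ sin t = val A 2 1.
  by apply: circle_angle; nra.
exists t; apply: val_inj; rewrite /= ct st.
by rewrite [LHS]mx33_eta h a01 a02 a10 a20 -e1 e2.
Qed.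

Lemma SO3_antifix0 (A : G) : val A 0 0 = -1 -> exists t, A = (rotx t * flip)%g.
Proof.
move=> h; have [|t e] := @SO3_fix0 (A * flip)%g.
  by rewrite /= [val A]mx33_eta mx33_mul !mxE /= h; ring.
by exists t; rewrite -e -mulgA flip2 mulg1.
Qed.

End DoubleCover.

(** * Axes of rotations *)

Section Axis.
Variable R : realType.
Local Notation C := R[i].
Local Notation K := (SU C 2).
Local Notation G := (SO R 3).
Local Notation rotx := (@rotx R).
Local Notation flip := (flip R).

(** Comparing first columns, the image of the first axis under [B] is fixed by [rotx t]. As [rotx t]
    is not trivial either, it fixes only the first axis, which [B] therefore preserves or
    reverses. *)
Lemma commute_rotx (B : G) s t : rotx s <> 1%g -> (B * rotx s = rotx t * B)%g ->
  val B 0 0 = 1 \/ val B 0 0 = -1.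
Proof.
move=> s1 e; have t1 : cos t <> 1.
  move=> /rotx_eq1 t1; apply: s1; apply: (mulgI B).
  by rewrite e t1 mul1g mulg1.
move/(congr1 val): e; rewrite /= {1 2}[val B]mx33_eta !mx33_mul.
move=> /mx33_inj[_ [+ _ _] [+ _ _]].
have [_] := SO3_orth B 0 0; rewrite big_ord3 /=.
move: (val B 0 0) (val B 1 0) (val B 2 0) => x y z xyz e1 e2.
have h := cos2Dsin2 t.
have y0 : y = 0.
  have : (1 - cos t) * y = 0 by nra.
  by move/eqP; rewrite mulf_eq0 subr_eq0 => /orP[/eqP|/eqP//] /esym.
have z0 : z = 0.
  have : (1 - cos t) * z = 0 by nra.
  by move/eqP; rewrite mulf_eq0 subr_eq0 => /orP[/eqP|/eqP//] /esym.
have : (x - 1) * (x + 1) = 0 by move: xyz; rewrite y0 z0; lra.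
by move/eqP; rewrite mulf_eq0 subr_eq0 addr_eq0 => /orP[] /eqP; [left|right].
Qed.

(** SU(2) acts transitively on the sphere: some rotation takes e_1 to (x, y, z). *)
Lemma rho_col0 (x y z : R) : x ^+ 2 + y ^+ 2 + z ^+ 2 = 1 ->
  exists U : K, [/\ val (rho U) 0 0 = x, val (rho U) 1 0 = y & val (rho U) 2 0 = z].
Proof.
move=> h; have [x1|x1] := eqVneq x (-1).
  (* The quaternion j is the half-turn about the second axis, which sends e_1 to -e_1. *)
  have [U eU] : exists U : K, val (rho U) = qrot 0 0 1 0 by apply: rho_qrot; ring.
  by exists U; rewrite eU !mxE /= x1; split; nra.
have x0 : 0 < 2 * (1 + x).
  have : -1 < x by rewrite lt_def x1; nra.
  by lra.
pose r := (Num.sqrt (2 * (1 + x)))^-1.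
have r2 : r ^+ 2 = (2 * (1 + x))^-1 by rewrite /r exprVn sqr_sqrtr // ltW.
have r2' : r ^+ 2 * (2 * (1 + x)) = 1 by rewrite r2 mulVf // gt_eqF.
(* This is the normalised quaternion 1 + <e_1, v> + e_1 x v, the shortest rotation from e_1 to v. *)
have [|U eU] := @rho_qrot R (r * (1 + x)) 0 (- r * z) (r * y).
  rewrite -[RHS]r2'; transitivity (r ^+ 2 * ((1 + x) ^+ 2 + z ^+ 2 + y ^+ 2)); first by ring.
  by congr (_ * _); lra.
exists U; rewrite eU !mxE /=; split.
- transitivity (r ^+ 2 * ((1 + x) ^+ 2 - z ^+ 2 - y ^+ 2)); first by ring.
  transitivity (r ^+ 2 * (2 * (1 + x)) * x); last by rewrite r2' mul1r.
  by rewrite -mulrA; congr (_ * _); lra.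
- transitivity (r ^+ 2 * (2 * (1 + x)) * y); last by rewrite r2' mul1r.
  by ring.
- transitivity (r ^+ 2 * (2 * (1 + x)) * z); last by rewrite r2' mul1r.
  by ring.
Qed.

(** Euler's theorem. In odd dimension A - 1 = A (1 - A^T) forces det (A - 1) to equal its own
    opposite, so A has a fixed vector; once normalised, it becomes the first column of [rho U]. *)
Lemma SO3_axis (A : G) : exists (U : K) t, (A ^ rho U)%g = rotx t.
Proof.
suff [U] : exists U : K, val (A ^ rho U)%g 0 0 = 1.
  by move=> /SO3_fix0[t At]; exists U, t.
have [/= A1 dA] := set_valP A; rewrite -/(val A) in A1 dA.
have : \det (val A - 1%:M) == 0.
  have : \det (val A - 1%:M) = - \det (val A - 1%:M).
    have {1}-> : val A - 1%:M = val A *m (1%:M - (val A)^T).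
      by rewrite mulmxBr mulmx1 A1.
    rewrite det_mulmx dA mul1r -det_tr linearB /= trmxK trmx1.
    by rewrite -opprB -scaleN1r detZ; ring.
  move=> e; apply/eqP; lra.
move=> /det0P[v v0 /eqP]; rewrite mulmxBr mulmx1 subr_eq0 => /eqP vA.
pose s := (v *m v^T) 0 0.
have sE : s = v 0 0 ^+ 2 + v 0 1 ^+ 2 + v 0 2 ^+ 2.
  by rewrite /s mxE big_ord3 !mxE !expr2.
have s0 : 0 < s.
  rewrite lt0r sE !addr_ge0 ?sqr_ge0 // andbT; apply: contraNneq v0.
  move/eqP; rewrite !paddr_eq0 ?addr_ge0 ?sqr_ge0 // !sqrf_eq0.
  move=> /andP[/andP[/eqP x /eqP y] /eqP z]; apply/eqP/matrixP => i j.
  rewrite ord1 !mxE; case: j => -[|[|[|//]]] Hj.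
  - by rewrite -[RHS]x; congr (v _ _); exact: val_inj.
  - by rewrite -[RHS]y; congr (v _ _); exact: val_inj.
  - by rewrite -[RHS]z; congr (v _ _); exact: val_inj.
pose r := (Num.sqrt s)^-1.
have r2 : r ^+ 2 * s = 1.
  by rewrite /r exprVn sqr_sqrtr ?ltW // mulVf // gt_eqF.
have [|U [Ux Uy Uz]] := @rho_col0 (r * v 0 0) (r * v 0 1) (r * v 0 2).
  by rewrite -[RHS]r2 sE; ring.
exists U; have cU : row 0 (val (rho U))^T = r *: v.
  apply/matrixP => i j; rewrite ord1 [RHS]mxE [LHS]mxE [LHS]mxE.
  case: j => -[|[|[|//]]] Hj.
  - rewrite (_ : Ordinal Hj = 0) ?Ux //; exact: val_inj.
  - rewrite (_ : Ordinal Hj = 1) ?Uy //; exact: val_inj.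
  - rewrite (_ : Ordinal Hj = 2) ?Uz //; exact: val_inj.
have -> : val (A ^ rho U)%g 0 0 =
    (row 0 (val (rho U))^T *m val A *m (row 0 (val (rho U))^T)^T) 0 0.
  have -> : val (A ^ rho U)%g = (val (rho U))^T *m (val A *m val (rho U)) by [].
  move: (val (rho U)) (val A) => Q B; rewrite -mulmxA 2!mxE; apply: eq_bigr => k _.
  rewrite [in RHS]mxE; congr (_ * _); rewrite [LHS]mxE [RHS]mxE.
  by apply: eq_bigr => l _; rewrite !mxE.
rewrite cU -scalemxAl vA linearZ /= -scalemxAl -scalemxAr scalerA !mxE -/(s).
by rewrite -r2 -expr2 /s mxE.
Qed.

End Axis.

(** * Preimages of small groups under the cover, and rotations of finite order *)

Section Klein.
Variable R : realType.
Local Notation C := R[i].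
Local Notation K := (SU C 2).
Local Notation G := (SO R 3).
Local Notation rotx := (@rotx R).
Local Notation flip := (flip R).

Lemma rho1 : rho (1 : K)%g = 1%g.
Proof. exact: morph1g (@rhoM R). Qed.

Lemma rhoV (U : K) : rho (U^-1)%g = ((rho U)^-1)%g.
Proof. exact: morphVg (@rhoM R) _. Qed.

Lemma rho_rotx t : exists U : K, rho U = rotx t.
Proof.
have [|U eU] := @rho_qrot R (cos (t / 2)) (sin (t / 2)) 0 0.
  by rewrite -[RHS](cos2Dsin2 (t / 2)); ring.
have ct : cos t = cos (t / 2) ^+ 2 - sin (t / 2) ^+ 2.
  by rewrite {1}(splitr t) cosD !expr2.
have st : sin t = 2 * (cos (t / 2) * sin (t / 2)).
  by rewrite {1}(splitr t) sinD; ring.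
exists U; apply: val_inj; rewrite eU /= /qrot ct st.
by congr mx33; first [ring|rewrite -[RHS](cos2Dsin2 (t / 2)); ring].
Qed.

Lemma rho_Q8_gen : rho (Q8_gen C) = flip.
Proof. by apply: val_inj; rewrite /= /rho_mx !mxE /= /qrot; congr mx33; ring. Qed.

Lemma rho_mu4_gen : rho (mu4_gen C) = rotx pi.
Proof.
apply: val_inj; rewrite /= /rho_mx !mxE /= /qrot cospi sinpi; congr mx33; ring.
Qed.

Lemma rotxDpi2 : rotx (pi *+ 2) = 1%g.
Proof. by apply/rotx_eq1; exact: cos2pi. Qed.

Lemma rotx_pi2 : (rotx pi * rotx pi = 1)%g.
Proof. by rewrite -rotxD -mulr2n rotxDpi2. Qed.

Lemma rotx_piV : ((rotx pi)^-1 = rotx pi)%g.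
Proof. by apply: (mulgI (rotx pi)); rewrite mulgV rotx_pi2. Qed.

Lemma rotx_pi_neq1 : rotx pi <> 1%g.
Proof. by move=> /rotx_eq1; rewrite cospi; lra. Qed.

Lemma rotx2_eq1 t : rotx (t *+ 2) = 1%g -> rotx t = 1%g \/ rotx t = rotx pi.
Proof.
move=> /rotx_eq1; rewrite cos_mulr2n => h.
have : (cos t - 1) * (cos t + 1) = 0 by rewrite mulr2n in h; nra.
move=> /eqP; rewrite mulf_eq0 subr_eq0 addr_eq0 => /orP[]/eqP ct.
  by left; apply/rotx_eq1.
have st : sin t = 0 by apply: cos1sin0; rewrite ct normrN1.
by right; apply: val_inj; rewrite /= ct st cospi sinpi.
Qed.

Lemma flip_rotx_pi : (flip * rotx pi = rotx pi * flip)%g.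
Proof. by rewrite flip_rotx rotxN rotx_piV. Qed.

Definition klein : set G :=
  [set A | exists e : bool * bool, A = (rotx pi ^+ e.1 * flip ^+ e.2)%g].

(** Conjugation by [flip] inverts rotations about the first axis, so commuting with it leaves only
    the angles 0 and pi. *)
Lemma commute_flip_klein (A : G) : val A 0 0 = 1 \/ val A 0 0 = -1 ->
  (A * flip = flip * A)%g -> klein A.
Proof.
have key t : (rotx t * flip = flip * rotx t)%g ->
    exists b : bool, rotx t = (rotx pi ^+ b)%g.
  rewrite flip_rotx => /mulIg; rewrite rotxN => e.
  have /rotx2_eq1[->|->] : rotx (t *+ 2) = 1%g by rewrite mulr2n rotxD {1}e mulVg.
    by exists false.
  by exists true; rewrite expg1.
move=> [/SO3_fix0|/SO3_antifix0] [t ->] h.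
  by have [b ->] := key _ h; exists (b, false); rewrite mulg1.
have [b ->] : exists b : bool, rotx t = (rotx pi ^+ b)%g.
  by apply: key; apply: (mulIg flip); rewrite h mulgA.
by exists (b, true); rewrite expg1.
Qed.

(** The kernel of the cover is {1, -1}, and -1 is the square of [mu4_gen]. *)
Lemma rho_eq1 (U : K) : rho U = 1%g -> U = 1%g \/ U = (mu4_gen C * mu4_gen C)%g.
Proof.
have [a [b [c [d [h eU]]]]] := SU_qmx U.
move=> /(congr1 val); rewrite /= eU rho_mx_qmx mx33_1.
move=> /mx33_inj[[h0 _ _] [_ h1 _] [_ _ h2]].
have b0 : b = 0 by nra. have c0 : c = 0 by nra. have d0 : d = 0 by nra.
have : (a - 1) * (a + 1) = 0 by nra.
move=> /eqP; rewrite mulf_eq0 subr_eq0 addr_eq0 => /orP[]/eqP a1; [left|right];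
  apply: val_inj; rewrite eU /= ?mx22_1 ?mx22_mul /qmx a1 b0 c0 d0;
  by congr mx22; apply/eqP; rewrite eq_complex /=; apply/andP; split; apply/eqP; ring.
Qed.

Lemma mu4_setM (U V : K) : mu4_set U -> mu4_set V -> mu4_set (U * V)%g.
Proof.
have /group_closedE[m1 mF] := generated_subgroup_closed [set mu4_gen C].
move=> mU mV; rewrite -[V]invgK; apply: (mF) => //.
by rewrite -[(V^-1)%g]mul1g; exact: mF.
Qed.

(** mu_4 contains the kernel of [rho], so it is the full preimage of its image, the group of order
    two generated by [rotx pi]. *)
Lemma mu4_setP (U : K) : mu4_set U <-> exists b : bool, rho U = (rotx pi ^+ b)%g.
Proof.
have m1 : mu4_set (mu4_gen C) by exact: sub_gen_smallest.
split=> [|[]].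
  apply: (@smallest_sub _ _ _ [set U : K | exists b : bool, rho U = (rotx pi ^+ b)%g]).
    apply/group_closedE; split=> [|x y [b xb] [c yc]]; first by exists false; rewrite rho1.
    exists (b (+) c); rewrite rhoM rhoV xb yc.
    case: b c {xb yc} => [] [] /=; rewrite ?expg1 ?expg0 ?invg1 ?mulg1 ?mulgV //.
    by rewrite mul1g rotx_piV.
  by move=> _ -> /=; exists true; rewrite rho_mu4_gen.
move=> b; have k1 (V : K) : rho V = 1%g -> mu4_set V.
  move=> /rho_eq1[]->; last exact: mu4_setM.
  by have /group_closedE[] := generated_subgroup_closed [set mu4_gen C].
case: b => [|/k1//]; rewrite expg1 => h.
have /k1 h1 : rho (U * mu4_gen C)%g = 1%g by rewrite rhoM h rho_mu4_gen rotx_pi2.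
(* [mu4_gen] has order four, so its cube is its inverse. *)
suff -> : U = (U * mu4_gen C * (mu4_gen C * mu4_gen C * mu4_gen C))%g.
  by apply: mu4_setM => //; do 2! apply: mu4_setM => //.
have k2 : (mu4_gen C * mu4_gen C * (mu4_gen C * mu4_gen C) = 1)%g.
  apply: val_inj; rewrite /= !mx22_mul mx22_1.
  by congr mx22; apply/eqP; rewrite eq_complex /=; apply/andP; split; apply/eqP; ring.
by rewrite -[LHS]mulg1 -k2 !mulgA.
Qed.

Lemma Q8_setP (U : K) : Q8_set U <-> klein (rho U).
Proof.
split=> [[/mu4_setP[b ->]|[V /mu4_setP[b Vb] <-]]|[[b c] /= e]].
- by exists (b, false); rewrite mulg1.
- exists (b, true); rewrite rhoM Vb rho_Q8_gen expg1.
  by case: b {Vb}; rewrite ?expg1 ?flip_rotx_pi // mulg1 mul1g.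
- case: c e => e; last by left; apply/mu4_setP; exists b; rewrite e mulg1.
  right; exists ((Q8_gen C)^-1 * U)%g; last by rewrite mulgA mulgV mul1g.
  apply/mu4_setP; exists b; rewrite rhoM rhoV rho_Q8_gen flipV e expg1.
  case: b {e}; rewrite ?expg1 ?expg0 ?mul1g ?flip2 // mulgA flip_rotx_pi -mulgA.
  by rewrite flip2 mulg1.
Qed.

Lemma rotx_int (m : int) : rotx ((pi *+ 2) *~ m) = 1%g.
Proof.
case: m => m; first by rewrite -pmulrn rotxMn rotxDpi2 expg1n.
by rewrite NegzE mulrNz rotxN -pmulrn rotxMn rotxDpi2 expg1n invg1.
Qed.

(** After reduction of the angle to y in [0, 2 pi), the formula cos y = 1 - 2 sin^2 (y/2) and the
    positivity of sin on ]0, pi[ leave only y = 0. *)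
Lemma rotx_eq1_int x : rotx x = 1%g -> exists m : int, x = (pi *+ 2) *~ m.
Proof.
have pi0 : 0 < (pi : R) by exact: pi_gt0.
have pi20 : 0 < (pi *+ 2 : R) by rewrite pmulrn_rgt0.
move=> x1; pose m := Num.floor (x / (pi *+ 2)); exists m.
pose y := x - (pi *+ 2) *~ m.
suff : y = 0 by move=> /eqP; rewrite subr_eq0 => /eqP.
have y1 : cos y = 1 by apply/rotx_eq1; rewrite rotxB rotx_int x1 invg1 mulg1.
have /andP[m1 m2] : m%:~R <= x / (pi *+ 2) < (m + 1)%:~R.
  by rewrite floor_le floorD1_gt.
have y0 : 0 <= y.
  by rewrite subr_ge0 -mulrzr mulrC -ler_pdivlMr.
have yp : y < pi *+ 2.
  rewrite ltrBlDl -{1}[X in _ + X]mulr1z -mulrzDr.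
  by rewrite -mulrzr mulrC -ltr_pdivrMr.
apply/eqP; apply: contraT => yn0.
have s0 : 0 < sin (y / 2).
  have y0' : 0 < y by rewrite lt_def yn0.
  by apply: sin_gt0_pi; rewrite mulr2n in yp; apply/andP; split; lra.
have : cos y = 1 - sin (y / 2) ^+ 2 *+ 2.
  by rewrite {1}(splitr y) -mulr2n cos_mulr2n cos2sin2; ring.
rewrite y1 => h; have : sin (y / 2) ^+ 2 = 0 by lra.
by move/eqP; rewrite sqrf_eq0 gt_eqF.
Qed.

Lemma root_rotx (N : nat) t : (0 < N)%N -> rotx (t *+ N) = 1%g ->
  exists2 k, (k < N)%N & rotx t = (rotx (pi *+ 2 / N%:R) ^+ k)%g.
Proof.
move=> N0 /rotx_eq1_int[m tm].
have N0' : N%:R != 0 :> R by rewrite pnatr_eq0 -lt0n.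
(* N t is 2 pi m, so only the residue of m modulo N matters for the rotation. *)
exists `|(m %% N)%Z|%N.
  by rewrite -ltz_nat gez0_abs ?modz_ge0 ?ltz_pmod // -lt0n.
have te : t = (pi *+ 2) *~ m / N%:R by rewrite -tm -[t *+ N]mulr_natr mulfK.
have te2 : t = (pi *+ 2) *~ (m %/ N)%Z + (pi *+ 2 / N%:R) *+ `|(m %% N)%Z|%N.
  rewrite te; apply: (mulIf N0'); rewrite mulfVK // mulrDl mulrnAl mulfVK //.
  rewrite [in LHS](divz_eq m N) mulrzDr; congr (_ + _).
    by rewrite mulrzA -[LHS]mulrzr.
  by rewrite -[in LHS](gez0_abs (modz_ge0 m _)) // -lt0n.
by rewrite te2 rotxD rotx_int mul1g rotxMn.
Qed.

Lemma rotx_order (N k : nat) : (0 < N)%N ->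
  (rotx (pi *+ 2 / N%:R) ^+ k = 1)%g <-> (N %| k)%N.
Proof.
move=> N0; have N0' : N%:R != 0 :> R by rewrite pnatr_eq0 -lt0n.
rewrite -rotxMn; split=> [/rotx_eq1_int[m]|/dvdnP[c ->]]; last first.
  by rewrite mulnC mulrnA -[X in rotx (X *+ _)]mulr_natr mulfVK // rotxMn rotxDpi2 expg1n.
have p0 : (pi *+ 2 : R) != 0 by rewrite mulrn_eq0 /= gt_eqF // pi_gt0.
move=> e; have {}e : k%:R = m%:~R * N%:R :> R.
  apply: (mulfI p0); rewrite mulrA mulrzr -e -[_ / _ *+ k]mulr_natr mulrAC.
  by rewrite mulfVK.
have : (k%:Z = m * N%:Z)%R.
  by apply/eqP; rewrite -(eqr_int R) intrM; apply/eqP.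
by move=> /(congr1 absz); rewrite abszM => /= ->; exact: dvdn_mull.
Qed.

End Klein.

(** * Dihedral normal forms *)

Section Dihedral.
Variable R : realType.
Local Notation C := R[i].
Local Notation K := (SU C 2).
Local Notation G := (SO R 3).
Local Notation rotx := (@rotx R).
Local Notation flip := (flip R).

(** The elements of the copy of O(2) in SO(3) that preserves the first axis; [b] records whether the
    axis is reversed. *)
Definition dih (t : R) (b : bool) : G := (rotx t * flip ^+ b)%g.

Lemma dih_rotx t : dih t false = rotx t.
Proof. exact: mulg1. Qed.

Lemma dihM s b t c : (dih s b * dih t c)%g = dih (s + (if b then - t else t)) (b (+) c).
Proof.
rewrite /dih; case: b => /=; last by rewrite !mulg1 rotxD mulgA.
rewrite expg1 rotxD -!mulgA; congr (_ * _)%g; rewrite mulgA flip_rotx -mulgA.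
by case: c; rewrite /= ?expg1 ?flip2 ?mulg1.
Qed.

Lemma dih0 : dih 0 false = 1%g.
Proof. by rewrite /dih rotx0 mulg1. Qed.

Lemma dihV t b : ((dih t b)^-1)%g = dih (if b then t else - t) b.
Proof.
apply: (mulgI (dih t b)); rewrite mulgV dihM addbb.
by case: b; rewrite subrr dih0.
Qed.

Lemma dih_flip : dih 0 true = flip.
Proof. by rewrite /dih rotx0 mul1g. Qed.

Lemma dih00 t b : val (dih t b) 0 0 = (-1) ^+ b.
Proof.
case: b; last by rewrite dih_rotx mxE expr0.
by rewrite /dih expg1 /= mx33_mul mxE /= expr1; ring.
Qed.

Lemma dihP (A : G) : val A 0 0 = 1 \/ val A 0 0 = -1 <-> exists t b, A = dih t b.
Proof.
split=> [[/SO3_fix0|/SO3_antifix0] [t ->]|[t [b ->]]].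
- by exists t, false; rewrite dih_rotx.
- by exists t, true.
- by rewrite dih00; case: b; [right; rewrite expr1|left].
Qed.

Lemma dih_inj_r s b t c : dih s b = dih t c -> b = c /\ rotx s = rotx t.
Proof.
rewrite /dih; case: b c => [] []; rewrite ?expg1 ?mulg1.
- by move=> /mulIg.
- by move=> /esym /rotx_neq_flip.
- by move=> /rotx_neq_flip.
- by [].
Qed.

(** The factor 2 in the angle is the source of all powers of 2: it bounds the orders of rotations in
    a nilpotent image and, conversely, makes the normal forms nilpotent. *)
Lemma dih_comm s b t c :
  [~ dih s b, dih t c]%g =
  rotx (((-1) ^+ (b && c) * ((if b then t else 0) - (if c then s else 0))) *+ 2).
Proof.
rewrite /commg /conjg !dihV !dihM -dih_rotx.
by case: b c => [] [] /=; rewrite ?expr0 ?expr1; congr dih; ring.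
Qed.

End Dihedral.

(** * SU(2) acting on homomorphisms by conjugation *)

Section ConjugationAction.
Variable R : realType.
Local Notation C := R[i].
Local Notation K := (SU C 2).
Local Notation G := (SO R 3).
Local Notation rotx := (@rotx R).
Local Notation flip := (flip R).

(** The inverse turns the right action [^] into a left action, as left cosets require. *)
Definition conj_act (T : Type) (U : K) (f : T -> G) : T -> G :=
  fun x => (f x ^ (rho U)^-1)%g.

Lemma conj_actM T (U V : K) (f : T -> G) :
  conj_act (U * V)%g f = conj_act U (conj_act V f).
Proof. by apply/funext => x; rewrite /conj_act rhoM invgM conjgM. Qed.

Lemma conj_act1 T (f : T -> G) : conj_act 1%g f = f.
Proof. by apply/funext => x; rewrite /conj_act rho1 invg1 conjg1. Qed.

Lemma conj_actK T (U : K) (f : T -> G) : conj_act (U^-1)%g (conj_act U f) = f.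
Proof. by rewrite -conj_actM mulVg conj_act1. Qed.

Lemma conj_act_morph (T : groupType) (U : K) (f : T -> G) :
  {morph f : x y / (x * y)%g} -> {morph conj_act U f : x y / (x * y)%g}.
Proof. by move=> fM x y; rewrite /conj_act fM conjMg. Qed.

(** For a rotation, corner entry 1 means fixing the first axis pointwise, so the image lies in a
    conjugate of the standard maximal torus. *)
Definition toral T (f : T -> G) := exists U : K, forall x, val (conj_act U f x) 0 0 = 1.

Lemma toral_conj T (U : K) (f : T -> G) : toral (conj_act U f) -> toral f.
Proof. by move=> [V h]; exists (V * U)%g; rewrite conj_actM. Qed.

End ConjugationAction.

(** * Nontoral nilpotent images are dihedral, and conversely *)

Section Nontoral.
Variables (R : realType) (n q : nat).
Local Notation C := R[i].
Local Notation K := (SU C 2).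
Local Notation G := (SO R 3).
Local Notation rotx := (@rotx R).
Local Notation flip := (flip R).
Local Notation F := (free_group n).
Local Notation Q := (free_nilpotent n q.+1).

(** Each commutator with [z] goes one step down the series and doubles the angle up to sign; q steps
    reach the trivial term. In [key], k counts the steps done and j those left. *)
Lemma nilpotent_rotx (h : F -> G) (z : F) : {morph h : x y / (x * y)%g} ->
  (forall x, lower_central F q.+1 x -> h x = 1%g) -> h z = flip ->
  forall y t, h y = rotx t -> rotx (t *+ 2 ^ q) = 1%g.
Proof.
move=> hM hq hz y t.
suff key j : forall k y t, lower_central F k.+1 y -> h y = rotx t ->
    (k + j)%N = q -> rotx (t *+ 2 ^ j) = 1%g.
  by move=> hy; exact: (key q 0%N y).
elim: j => [|j IHj] k {}y {}t yk hy; first by rewrite addn0 => kq; rewrite -hy hq -?kq.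
rewrite addnS -addSn => kq.
have := IHj k.+1 [~ y, z]%g (t *- 2) (lower_central_comm _ yk) _ kq.
rewrite (morphRg hM) hy hz -dih_rotx -dih_flip dih_comm /= expr0 mul1r sub0r.
rewrite mulNrn => /(_ erefl); rewrite mulNrn rotxN => /(congr1 (fun A : G => A^-1)%g) /=.
by rewrite invgK invg1 -mulrnA -expnS.
Qed.

Lemma nontoral_axis (f : Q -> G) : {morph f : x y / (x * y)%g} -> ~ toral f ->
  exists U : K, forall x, exists t b, conj_act U f x = dih t b.
Proof.
move=> fM nt; pose h x := f (nil_pi q.+1 x).
have hM : {morph h : x y / (x * y)%g} by move=> x y; rewrite /h nil_piM fM.
pose P k := `[< forall x, lower_central F k.+1 x -> h x = 1%g >].
have Pq : P q by apply/asboolP => x xq; rewrite /h nil_pi_eq1 // (morph1g fM).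
have [k /asboolP Pk kmin] := ex_minnP (ex_intro P q Pq).
(* For k = 0 all of Gamma^1 is killed: the homomorphism is trivial, hence toral. Otherwise
   minimality provides a nontrivial value on the preceding term, and it commutes with the whole
   image. *)
case: k Pk kmin => [|k] Pk kmin.
  case: nt; exists 1%g => x; rewrite conj_act1 -(nil_pi_repr x) -/(h _) Pk //.
  by rewrite mxE.
have [y yk hy] : exists2 y, lower_central F k.+1 y & h y <> 1%g.
  apply/not_exists2P => H; suff /kmin : P k by rewrite ltnn.
  by apply/asboolP => x xk; have [//|] := H x; apply: contra_notP.
have [U [t Ut]] := SO3_axis (h y); exists (U^-1)%g => x; apply/dihP.
rewrite /conj_act rhoV invgK; apply: (@commute_rotx _ _ t t).
  by move=> t1; apply: hy; rewrite -[h y](conjgK (rho U)) Ut t1 conj1g.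
rewrite -Ut -!conjMg; congr (_ ^ _)%g; rewrite -(nil_pi_repr x) -/(h _).
have : [~ h y, h (repr x)]%g = 1%g.
  by rewrite -(morphRg hM) Pk //; exact: lower_central_comm.
by move=> /eqP/commgP.
Qed.

(** [e] is found before [i0] is chosen, so that a user of the lemma may take for [i0] the first
    reversing generator. *)
Lemma nontoral_normal_form (f : Q -> G) : {morph f : x y / (x * y)%g} -> ~ toral f ->
  exists e : 'I_n -> bool, (exists i, e i) /\
  forall i0, e i0 -> exists (U : K) (t : 'I_n -> R),
    [/\ t i0 = 0, forall i, rotx (t i *+ 2 ^ q) = 1%g
      & forall i, conj_act U f (nil_gen q.+1 i) = dih (t i) (e i)].
Proof.
move=> fM nt; have [U Uf] := nontoral_axis fM nt.
have [s sP] := choice (fun i => Uf (nil_gen q.+1 i)).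
have [e eP] := choice sP; exists e; split.
  apply: contra_notP nt => /forallNP ne; exists U.
  suff H x : exists t, conj_act U f x = rotx t by move=> x; have [t ->] := H x; rewrite mxE.
  move: x; apply: nil_gen_ind.
  - by exists 0; rewrite rotx0 (morph1g (conj_act_morph U fM)).
  - move=> x y [t xt] [t' yt]; exists (t - t').
    by rewrite (conj_act_morph U fM) (morphVg (conj_act_morph U fM)) xt yt rotxB.
  - by move=> i; exists (s i); rewrite eP (negPf (introN idP (ne i))) dih_rotx.
(* Conjugation by the rotation of angle -s/2 shifts every reversing angle by -s, which brings the
   one at [i0] to 0. *)
move=> i0 ei0; have [W Wt] := rho_rotx (- (s i0) / 2).
pose t i := if e i then s i - s i0 else s i.
have gE i : conj_act (W * U)%g f (nil_gen q.+1 i) = dih (t i) (e i).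
  rewrite conj_actM {1}/conj_act eP Wt -rotxN -dih_rotx /conjg dihV !dihM addbF /t.
  by case: (e i); congr dih; field.
have gM := conj_act_morph (W * U)%g fM.
have t0 : t i0 = 0 by rewrite /t ei0 subrr.
exists (W * U)%g, t; split=> // i.
pose h x := conj_act (W * U)%g f (nil_pi q.+1 x).
have hM : {morph h : x y / (x * y)%g} by move=> x y; rewrite /h nil_piM gM.
have hq x : lower_central F q.+1 x -> h x = 1%g.
  by move=> xq; rewrite /h nil_pi_eq1 // (morph1g gM).
have h0 : h (free_gen i0) = flip by rewrite /h gE t0 ei0 dih_flip.
have hi : h (free_gen i) = dih (t i) (e i) by exact: gE.
case ei: (e i) hi => hi; last by apply: (nilpotent_rotx hM hq h0 (y := free_gen i)); rewrite hi dih_rotx.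
(* A reversing generator becomes a rotation of the same angle when multiplied by generator [i0],
   whose image is [flip]. *)
apply: (nilpotent_rotx hM hq h0 (y := (free_gen i * free_gen i0)%g)).
by rewrite hM hi h0 -dih_flip dihM oppr0 addr0 dih_rotx.
Qed.

Section Construct.
Variables (t : 'I_n -> R) (e : 'I_n -> bool).
Hypothesis q0 : (0 < q)%N.
Hypothesis tq : forall i, rotx (t i *+ 2 ^ q) = 1%g.

Let g i := dih (t i) (e i).

Lemma free_eval_dih x : exists s b, rotx (s *+ 2 ^ q) = 1%g /\ free_eval g x = dih s b.
Proof.
move: x; apply: free_group_gen_ind => [|x y [s [b [sq xs]]] [s' [b' [sq' ys]]]|i].
- by exists 0, false; rewrite (morph1g (free_evalM g)) dih0 mul0rn rotx0.
- rewrite free_evalM (morphVg (free_evalM g)) xs ys dihV dihM.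
  exists (s + (if b then - (if b' then s' else - s') else (if b' then s' else - s'))), (b (+) b').
  split=> //; rewrite mulrnDl rotxD sq mul1g.
  by case: (b) (b') => [] []; rewrite ?opprK ?mulNrn ?rotxN sq' ?invg1.
- by exists (t i), (e i); rewrite free_eval_gen.
Qed.

Lemma free_eval_dih_nil x : lower_central F q.+1 x -> free_eval g x = 1%g.
Proof.
(* Gamma^(k'+2) maps to rotations killed by 2^(q-1-k'). Truncated subtraction makes this the trivial
   group from k' = q - 1 on, which is the term Gamma^(q+1) wanted. *)
pose H k := if k is k'.+2 then
  [set x | exists2 s, rotx (s *+ 2 ^ (q.-1 - k')) = 1%g & free_eval g x = rotx s]
  else [set: F].
have key : forall k x, lower_central F k.+1 x -> H k.+1 x.
  apply: lower_central_sub => // [[|k]|[|k] {}x y].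
  - exact/group_closedE.
  - apply/group_closedE; split=> [|a b [s s1 as_] [s' s1' bs]].
      by exists 0; rewrite ?mul0rn ?rotx0 // (morph1g (free_evalM g)).
    exists (s - s'); last by rewrite free_evalM (morphVg (free_evalM g)) as_ bs rotxB.
    by rewrite mulrnBl rotxB s1 s1' invg1 mulg1.
  - move=> _; have [s [b [s1 xs]]] := free_eval_dih x.
    have [s' [b' [s1' ys]]] := free_eval_dih y.
    rewrite /H /= (morphRg (free_evalM g)) xs ys dih_comm; eexists; last by [].
    rewrite subn0 -mulrnA -expnS prednK // -mulrnAr mulrnBl.
    case: (b) (b') => [] []; rewrite /= ?mul0rn ?subr0 ?sub0r ?subrr ?mulr0 ?rotx0 //;
      rewrite ?expr0 ?expr1 ?mul1r ?mulN1r ?rotxN ?rotxB ?s1 ?s1' ?invg1 ?mulg1 ?invg1 //.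
  - move=> [s s1 xs]; have [s' [b' [s1' ys]]] := free_eval_dih y.
    rewrite /H /= (morphRg (free_evalM g)) xs ys -dih_rotx dih_comm /= expr0 mul1r sub0r.
    eexists; last by [].
    case: b' {ys}; last by rewrite oppr0 !mul0rn rotx0.
    rewrite !mulNrn rotxN -mulrnA; apply: (canLR invgK); rewrite invg1.
    (* Once the exponent has dropped to 0 the rotation is already trivial, and doubling keeps it
       so. *)
    move: s1; case: (ltnP k q.-1) => kq; first by rewrite -expnS subnSK.
    have /eqP -> : (q.-1 - k == 0)%N by rewrite subn_eq0.
    by rewrite expn0 mulr1n => s1; rewrite rotxMn s1 expg1n.
move=> /key; case: (q) q0 @H {key} => [//|p] _ /= [s + ->].
by rewrite subnn.
Qed.

End Construct.
End Nontoral.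

(** * Rigidity of dihedral families under conjugation *)

Section DihedralConjugation.
Variable R : realType.
Local Notation C := R[i].
Local Notation K := (SU C 2).
Local Notation G := (SO R 3).
Local Notation rotx := (@rotx R).
Local Notation flip := (flip R).

Lemma dihJ t e a c : (dih t e ^ dih a c)%g =
  dih ((-1) ^+ c * (t - (if e then a *+ 2 else 0)) : R) e.
Proof.
rewrite /conjg dihV !dihM.
by case: c e => [] []; rewrite /= ?expr0 ?expr1; congr dih; ring.
Qed.

Lemma dih_sqr t e : (dih t e * dih t e)%g = rotx (if e then 0 else t *+ 2).
Proof. by rewrite dihM addbb -dih_rotx; case: e; rewrite ?subrr. Qed.

Lemma dih_eq_rotx s t b : rotx s = rotx t -> dih s b = dih t b.
Proof. by rewrite /dih => ->. Qed.

(** The rotation of angle [t j] has order greater than two, so its conjugate cannot reverse the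
    axis, and [A] must preserve the axis; the normalisation at [i0] then kills twice the angle of
    [A]. The condition on [t' i0] presupposes [e =1 e'] because the second family is known to be
    normalised at the same index only when the signs agree. *)
Lemma conj_dih_family (n : nat) (t t' : 'I_n -> R) (e e' : 'I_n -> bool) (A : G) i0 j :
  e i0 -> t i0 = 0 -> (e =1 e' -> rotx (t' i0) = 1%g) -> rotx (t j *+ 2) <> 1%g ->
  (forall i, (dih (t i) (e i) ^ A)%g = dih (t' i) (e' i)) ->
  e =1 e' /\ exists b c : bool, A = (rotx pi ^+ b * flip ^+ c)%g /\
    forall i, rotx (t' i) = rotx (if c then - t i else t i).
Proof.
move=> ei0 ti0 t'i0 tj H.
(* The rotation of angle [t j] is the image of generator j, or of its product with generator [i0]
   when j reverses the axis. *)
have [u [b ub]] : exists u b, (rotx (t j) ^ A)%g = dih u b.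
  case ej: (e j); last by exists (t' j), (e' j); rewrite -dih_rotx -ej.
  exists (t' j + (if e' j then - t' i0 else t' i0)), (e' j (+) e' i0).
  by rewrite -dihM -!H -conjMg dihM ej ei0 ti0 oppr0 addr0 dih_rotx.
have b0 : b = false.
  apply/negbTE/negP => bT; apply: tj; rewrite mulr2n rotxD.
  by apply: (conjg_inj A); rewrite conjMg ub dih_sqr bT rotx0 conj1g.
rewrite b0 dih_rotx in ub.
have [a [c Aac]] : exists a c, A = dih a c.
  apply/dihP/(@commute_rotx _ A u (t j)).
    move=> u1; rewrite u1 in ub; apply: tj; rewrite mulr2n rotxD.
    by apply: (conjg_inj A); rewrite conjMg ub mulg1 conj1g.
  by rewrite -ub /conjg mulVKg.
have ee i : e i = e' i by have := H i; rewrite Aac dihJ => /dih_inj_r[].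
have tt i : rotx (t' i) = rotx ((-1) ^+ c * (t i - (if e i then a *+ 2 else 0))).
  by have := H i; rewrite Aac dihJ => /dih_inj_r[_ ->].
have a2 : rotx (a *+ 2) = 1%g.
  have := tt i0; rewrite t'i0 // ei0 ti0 sub0r; case: (c); rewrite ?expr1 ?expr0.
    by rewrite mulN1r opprK.
  by rewrite mul1r rotxN => /esym/(canRL invgK); rewrite invg1.
split=> //; have [b' ab'] : exists b' : bool, rotx a = (rotx pi ^+ b')%g.
  by have [->|->] := rotx2_eq1 a2; [exists false|exists true].
exists b', c; split; first by rewrite Aac /dih ab'.
move=> i; rewrite tt; case: (e i); last first.
  by case: (c); rewrite subr0 ?expr1 ?expr0 ?mulN1r ?mul1r.
case: (c); rewrite ?expr1 ?expr0 ?mulN1r ?mul1r ?opprB rotxB a2 ?mul1g ?rotxN //.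
by rewrite invg1 mulg1.
Qed.

Lemma conj_dih_pi t e (b : bool) : (dih t e ^ (rotx pi ^+ b))%g = dih t e.
Proof.
case: b; last by rewrite expg0 conjg1.
rewrite expg1 -dih_rotx dihJ expr0 mul1r; apply: dih_eq_rotx.
by case: e; rewrite ?subr0 // rotxB rotxDpi2 invg1 mulg1.
Qed.

Lemma conj_dih_flip t e : (dih t e ^ flip)%g = dih (- t) e.
Proof. by rewrite -dih_flip dihJ mul0rn; case: e; rewrite subr0 expr1 mulN1r. Qed.

(** A torus of SO(3) has a single involution. [f y] is one, and [f x] commutes with it, so the angle
    [u] is 0 or pi; if it were pi, [f x] would be a second involution. *)
Lemma toral_no_dih (T : Type) (f : T -> G) x y u v : toral f ->
  f x = rotx u -> f y = dih v true -> rotx u = 1%g.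
Proof.
move=> [U Uf] fx fy; have /SO3_fix0[u' eu] := Uf x; have /SO3_fix0[v' ev] := Uf y.
move: eu ev; rewrite /conj_act fx fy; set A := ((rho U)^-1)%g => eu ev.
have fv : rotx v' = rotx pi.
  have [|v1|//] := @rotx2_eq1 R v'.
    by rewrite mulr2n rotxD -ev -conjMg dih_sqr rotx0 conj1g.
  have := ev; rewrite v1 => /(canRL (conjgK A)); rewrite conj1g -dih0.
  by move=> /dih_inj_r[].
have [|//|u1] := @rotx2_eq1 R u.
  have : (rotx u * dih v true = dih v true * rotx u)%g.
    by apply: (conjg_inj A); rewrite [LHS]conjMg [RHS]conjMg eu ev -!rotxD addrC.
  rewrite -dih_rotx !dihM => /dih_inj_r[_].
  rewrite rotxD rotxB [X in _ = X](_ : _ = (rotx (- u) * rotx v)%g); last first.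
    by rewrite -rotxD addrC rotxB.
  by move=> /mulIg e; rewrite mulr2n rotxD {1}e rotxN mulVg.
exfalso; have [|u2|u2] := @rotx2_eq1 R u'.
- by rewrite mulr2n rotxD -eu -conjMg u1 rotx_pi2 conj1g.
- have := eu; rewrite u2 => /(canRL (conjgK A)); rewrite conj1g u1.
  exact: rotx_pi_neq1.
- rewrite u2 -fv -ev in eu; have := @conjg_inj _ A _ _ eu.
  exact: rotx_neq_flip.
Qed.

End DihedralConjugation.

(** * Z/2^p as a group of rotations *)

Section CyclicRotations.
Variables (R : realType) (p : nat).
Hypothesis p0 : (0 < p)%N.
Local Notation G := (SO R 3).
Local Notation rotx := (@rotx R).
Local Notation N := (2 ^ p)%N.

(** The lift uses the representative in [0, N), so it is additive only modulo 2 pi and is used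
    through [rotx]. The hypothesis [p0] makes 'Z_N the true Z/N, since 'Z_1 has two elements. *)
Definition zangle (k : 'Z_N) : R := (pi *+ 2 / N%:R) *+ k.

Lemma Z2p_cast : (Zp_trunc N).+2 = N.
Proof. by apply: Zp_cast; rewrite -{1}(expn0 2) ltn_exp2l. Qed.

Lemma rotx_zangle (k : 'Z_N) : rotx (zangle k) = (rotx (pi *+ 2 / N%:R) ^+ k)%g.
Proof. by rewrite /zangle rotxMn. Qed.

Lemma rotx_zangle_mod (m : nat) :
  (rotx (pi *+ 2 / N%:R) ^+ (m %% N))%g = (rotx (pi *+ 2 / N%:R) ^+ m)%g.
Proof.
have N0 : (0 < N)%N by rewrite expn_gt0.
rewrite [in RHS](divn_eq m N) expgnDr.
have -> : (rotx (pi *+ 2 / N%:R) ^+ (m %/ N * N) = 1)%g.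
  by apply/rotx_order => //; exact: dvdn_mull.
by rewrite mul1g.
Qed.

Lemma rotx_zangleD (k l : 'Z_N) :
  rotx (zangle (k + l)) = (rotx (zangle k) * rotx (zangle l))%g.
Proof.
have modE m : (m %% (Zp_trunc N).+2 = m %% N)%N by rewrite Z2p_cast.
by rewrite !rotx_zangle -expgnDr /= (modE (k + l)%N) rotx_zangle_mod.
Qed.

Lemma rotx_zangle0 : rotx (zangle 0) = 1%g.
Proof. by rewrite rotx_zangle. Qed.

Lemma rotx_zangleN (k : 'Z_N) : rotx (zangle (- k)) = rotx (- zangle k).
Proof.
rewrite rotxN; apply: (mulgI (rotx (zangle k))).
by rewrite -rotx_zangleD subrr rotx_zangle0 mulgV.
Qed.

Lemma rotx_zangle_eq1 (k : 'Z_N) : rotx (zangle k) = 1%g -> k = 0.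
Proof.
rewrite rotx_zangle => /rotx_order; rewrite expn_gt0 => /(_ isT) Nk.
have kN : (k < N)%N by rewrite -[X in (_ < X)%N]Z2p_cast.
by apply: val_inj => /=; rewrite -(modn_small kN); apply/eqP.
Qed.

Lemma rotx_zangle_inj (k l : 'Z_N) : rotx (zangle k) = rotx (zangle l) -> k = l.
Proof.
move=> kl; apply/eqP; rewrite -subr_eq0; apply/eqP/rotx_zangle_eq1.
by rewrite rotx_zangleD rotx_zangleN rotxN kl mulgV.
Qed.

Lemma rotx_zangle_double (k : 'Z_N) : rotx (zangle k *+ 2) = rotx (zangle (k *+ 2)).
Proof. by rewrite !mulr2n rotx_zangleD rotxD. Qed.

Lemma rotx_zangle_exp (k : 'Z_N) : rotx (zangle k *+ 2 ^ p) = 1%g.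
Proof.
rewrite rotxMn rotx_zangle -expgnA; apply/rotx_order; first by rewrite expn_gt0.
exact: dvdn_mull.
Qed.

Lemma rotx_zangle_onto t : rotx (t *+ 2 ^ p) = 1%g -> exists k : 'Z_N, rotx t = rotx (zangle k).
Proof.
move=> /root_rotx; rewrite expn_gt0 => /(_ isT)[k kN ->].
exists (inord k); rewrite rotx_zangle inordK //.
by rewrite Z2p_cast.
Qed.

End CyclicRotations.

(** * Normal forms with stabiliser mu_4 *)

Section DihedralNormalForms.
Variables (R : realType) (n p : nat).
Hypothesis p0 : (0 < p)%N.
Local Notation C := R[i].
Local Notation K := (SU C 2).
Local Notation G := (SO R 3).
Local Notation rotx := (@rotx R).
Local Notation flip := (flip R).
Local Notation Q := (free_nilpotent n p.+1).
Local Notation N := (2 ^ p)%N.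
Local Notation gen := (@nil_gen n p.+1).

Definition dih_hom (t : 'I_n -> R) (e : 'I_n -> bool) : Q -> G :=
  nil_eval (q := p.+1) (fun i => dih (t i) (e i)).

Section DihHom.
Variables (t : 'I_n -> R) (e : 'I_n -> bool).
Hypothesis tq : forall i, rotx (t i *+ 2 ^ p) = 1%g.

Lemma dih_homM : {morph dih_hom t e : x y / (x * y)%g}.
Proof. exact: (nil_evalM (free_eval_dih_nil e p0 tq)). Qed.

Lemma dih_hom_gen i : dih_hom t e (gen i) = dih (t i) (e i).
Proof. exact: (nil_eval_gen (free_eval_dih_nil e p0 tq)). Qed.

Lemma conj_dih_hom (U : K) (f : Q -> G) : {morph f : x y / (x * y)%g} ->
  (forall i, f (gen i) = (dih (t i) (e i) ^ (rho U)^-1)%g) ->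
  conj_act U (dih_hom t e) = f.
Proof.
move=> fM fE; apply: nil_morph_ext => //; first exact: (conj_act_morph U dih_homM).
by move=> i; rewrite fE /conj_act dih_hom_gen.
Qed.

End DihHom.

Local Notation bvec := {ffun 'I_n -> bool}.
Local Notation zvec := {ffun 'I_n -> 'Z_N}.

(* The suffixes 4 and 8 refer to the stabiliser in SU(2), mu_4 or Q_8. *)
Definition hom4 (s : bvec * zvec) : Q -> G := dih_hom (fun i => zangle R (s.2 i)) s.1.

(* The first generator sent to a half-turn is normalised to be sent to [flip]. *)
Definition normal4 (s : bvec * zvec) : bool :=
  oapp (fun i => s.2 i == 0) false [pick i | s.1 i].

(** The second condition provides a rotation of order greater than two, which excludes images inside
    a Klein group. *)
Definition S4 : {set bvec * zvec} :=
  [set s | normal4 s && [exists i, s.2 i *+ 2 != 0]]%SET.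

(** A complete conjugacy invariant: the only conjugation left between normal forms is by [flip],
    which negates the angles. *)
Definition phi4 (s : bvec * zvec) : bvec * {set zvec} :=
  (s.1, [set s.2; - s.2]%SET).

Lemma hom4_angle (s : bvec * zvec) i : rotx (zangle R (s.2 i) *+ 2 ^ p) = 1%g.
Proof. exact: rotx_zangle_exp. Qed.

Lemma hom4M s : {morph hom4 s : x y / (x * y)%g}.
Proof. exact: (dih_homM _ (hom4_angle s)). Qed.

Lemma hom4_gen s i : hom4 s (gen i) = dih (zangle R (s.2 i)) (s.1 i).
Proof. exact: (dih_hom_gen _ (hom4_angle s)). Qed.

Lemma normal4P s : normal4 s ->
  exists i0, [/\ [pick i | s.1 i] = Some i0, s.1 i0 & s.2 i0 = 0].
Proof.
by rewrite /normal4; case: pickP => //= i0 si0 /eqP s0; exists i0.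
Qed.

Lemma S4P s : s \in S4 -> normal4 s /\ exists i, s.2 i *+ 2 <> 0.
Proof.
by rewrite inE => /andP[-> /existsP[i /eqP si]]; split=> //; exists i.
Qed.

Lemma conj_hom4 s s' (U : K) : s \in S4 -> normal4 s' ->
  conj_act U (hom4 s) = hom4 s' ->
  s'.1 = s.1 /\ exists b c : bool, ((rho U)^-1 = rotx pi ^+ b * flip ^+ c)%g /\
    s'.2 = if c then - s.2 else s.2.
Proof.
move=> /S4P[/normal4P[i0 [pi0 si0 ti0]] [j sj]] n' H.
have [||||i|ee [b [c [Abc tt]]]] := @conj_dih_family R n
  (fun i => zangle R (s.2 i)) (fun i => zangle R (s'.2 i)) s.1 s'.1 (rho U)^-1%g i0 j.
- by [].
- by rewrite ti0.
- move=> ee; have [i1 [pi1 _ ti1]] := normal4P n'.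
  suff <- : i1 = i0 by rewrite ti1 rotx_zangle0.
  by apply: Some_inj; rewrite -pi0 -pi1; apply: eq_pick => i /=; rewrite ee.
- by rewrite rotx_zangle_double // => /(rotx_zangle_eq1 p0).
- by rewrite -!hom4_gen -H.
split; first by apply/ffunP => i; rewrite ee.
exists b, c; split=> //; apply/ffunP => i; apply: (@rotx_zangle_inj R p p0).
by rewrite tt; case: (c); rewrite ?ffunE ?rotx_zangleN.
Qed.

Lemma conj_hom4_pi s (U : K) (b : bool) : ((rho U)^-1 = rotx pi ^+ b)%g ->
  conj_act U (hom4 s) = hom4 s.
Proof.
move=> Ub; apply: (conj_dih_hom (hom4_angle s)); first exact: hom4M.
by move=> i; rewrite hom4_gen Ub conj_dih_pi.
Qed.

Lemma conj_hom4_opp s : exists U : K, conj_act U (hom4 s) = hom4 (s.1, - s.2).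
Proof.
exists (Q8_gen C); apply: (conj_dih_hom (hom4_angle s)); first exact: hom4M.
move=> i; rewrite hom4_gen rho_Q8_gen flipV conj_dih_flip ffunE.
by apply: dih_eq_rotx; rewrite rotx_zangleN.
Qed.

Lemma hom4_conjP s s' : s \in S4 -> s' \in S4 ->
  (exists U : K, conj_act U (hom4 s) = hom4 s') <-> phi4 s = phi4 s'.
Proof.
move=> sS s'S; have [n' _] := S4P s'S; split=> [[U /(conj_hom4 sS n')]|].
  move=> [e1 [b [c [_ e2]]]]; rewrite /phi4 e1 e2; congr pair.
  by case: (c) => //; rewrite opprK finset.setUC.
move=> [e1 /setP /(_ s'.2)]; rewrite !inE eqxx => /orP[]/eqP e2.
  by exists 1%g; rewrite conj_act1 [s]surjective_pairing [s']surjective_pairing e1 e2.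
by have [U HU] := conj_hom4_opp s; exists U; rewrite HU [s']surjective_pairing e1 e2.
Qed.

Lemma hom4_stabP s (U : K) : s \in S4 -> conj_act U (hom4 s) = hom4 s <-> mu4_set U.
Proof.
move=> sS; have [n' [i si]] := S4P sS; split=> [/(conj_hom4 sS n')|/mu4_setP[b Ub]].
  move=> [_ [b [c [Ubc e2]]]]; apply/mu4_setP; exists b.
  (* Conjugation by [flip] negates all angles; fixing them would make every angle 2-torsion. *)
  case: c Ubc e2 => [_ e2|Ub _].
    by case: si; rewrite mulr2n {1}e2 ffunE addNr.
  rewrite -[rho U]invgK Ub mulg1; case: (b); rewrite ?expg1 ?rotx_piV //.
  by rewrite expg0 invg1.
apply: (@conj_hom4_pi _ _ b); rewrite Ub.
by case: (b); rewrite ?expg1 ?rotx_piV // expg0 invg1.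
Qed.

Lemma hom4_nontoral s : s \in S4 -> ~ toral (hom4 s).
Proof.
move=> /S4P[/normal4P[i0 [_ si0 ti0]] [j sj]] tor.
have h0 : hom4 s (gen i0) = dih (zangle R (s.2 i0)) true by rewrite hom4_gen si0.
have t0 : zangle R (s.2 i0) = 0 by rewrite ti0.
suff [y hy] : exists y, hom4 s y = rotx (zangle R (s.2 j)).
  have /(rotx_zangle_eq1 p0) := toral_no_dih tor hy h0.
  by move=> sj0; apply: sj; rewrite sj0 mul0rn.
case ej: (s.1 j); last by exists (gen j); rewrite hom4_gen ej dih_rotx.
exists (gen j * gen i0)%g; rewrite hom4M h0 hom4_gen ej t0 dihM oppr0 addr0.
by rewrite dih_rotx.
Qed.

(** This separates the family from the Klein one, where every square is 1. *)
Lemma hom4_sqr s : s \in S4 -> exists x, (hom4 s x * hom4 s x)%g <> 1%g.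
Proof.
move=> /S4P[/normal4P[i0 [_ si0 ti0]] [j sj]].
suff [y hy] : exists y, hom4 s y = rotx (zangle R (s.2 j)).
  by exists y; rewrite hy -rotxD -mulr2n rotx_zangle_double // => /(rotx_zangle_eq1 p0).
case ej: (s.1 j); last by exists (gen j); rewrite hom4_gen ej dih_rotx.
exists (gen j * gen i0)%g; rewrite hom4M !hom4_gen ej si0 ti0 dihM oppr0 addr0.
by rewrite dih_rotx.
Qed.

End DihedralNormalForms.

(** * Normal forms with stabiliser Q_8 *)

Section KleinNormalForms.
Variables (R : realType) (n p : nat).
Hypothesis p0 : (0 < p)%N.
Local Notation C := R[i].
Local Notation K := (SU C 2).
Local Notation G := (SO R 3).
Local Notation rotx := (@rotx R).
Local Notation flip := (flip R).
Local Notation Q := (free_nilpotent n p.+1).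
Local Notation gen := (@nil_gen n p.+1).
Local Notation bvec := {ffun 'I_n -> bool}.

(** The Klein group as (Z/2)^2: [x] and [y] are the sign exponents of the first two diagonal
    entries. *)
Definition kdiag (x y : bool) : G := dih (pi *+ y) x.

Lemma kdiagM x y x' y' : (kdiag x y * kdiag x' y')%g = kdiag (x (+) x') (y (+) y').
Proof.
rewrite /kdiag dihM; apply: dih_eq_rotx.
rewrite rotxD; have -> : rotx (if x then - (pi *+ y') else pi *+ y') = rotx (pi *+ y').
  by case: x; rewrite // rotxN; case: y'; rewrite ?mulr0n ?rotx0 ?invg1 ?mulr1n ?rotx_piV.
by rewrite -rotxD -mulrnDr; case: y y' => [] []; rewrite //= rotxDpi2 rotx0.
Qed.

Lemma kdiag1 : kdiag false false = 1%g.
Proof. exact: dih0. Qed.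

Lemma kdiag_klein x y : klein (kdiag x y).
Proof. by exists (y, x); rewrite /kdiag /dih rotxMn. Qed.

Lemma klein_kdiag (A : G) : klein A -> exists x y, A = kdiag x y.
Proof. by move=> [[y x] ->]; exists x, y; rewrite /kdiag /dih rotxMn. Qed.

Lemma kdiagV x y : ((kdiag x y)^-1)%g = kdiag x y.
Proof. by apply: (mulgI (kdiag x y)); rewrite mulgV kdiagM !addbb kdiag1. Qed.

Lemma kdiagJ x y x' y' : (kdiag x y ^ kdiag x' y')%g = kdiag x y.
Proof.
rewrite /conjg kdiagV !kdiagM.
by congr kdiag; [case: (x) x' => [] []|case: (y) y' => [] []].
Qed.

Definition xorv (a b : bvec) : bvec := [ffun i => a i (+) b i].

(** The three diagonal sign characters of [hom8 s], on generators; determinant 1 makes the third the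
    product of the others. *)
Definition chi (s : bvec * bvec) (k : 'I_3) : bvec :=
  if k == 0 then s.1 else if k == 1 then s.2 else xorv s.1 s.2.

Lemma kdiag_mx33 x y :
  val (kdiag x y) = mx33 ((-1) ^+ x) 0 0 0 ((-1) ^+ y) 0 0 0 ((-1) ^+ (x (+) y)).
Proof.
rewrite /kdiag /dih; case: x y => [] [];
rewrite ?expg1 ?expg0 ?mulg1 ?mulr1n ?mulr0n /= ?mx33_mul ?cospi ?sinpi ?cos0 ?sin0;
  rewrite ?expr0 ?expr1; congr mx33; ring.
Qed.

Lemma val_kdiag (s : bvec * bvec) i (k l : 'I_3) :
  val (kdiag (s.1 i) (s.2 i)) k l = if k == l then (-1) ^+ chi s k i else 0.
Proof.
rewrite kdiag_mx33 /chi.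
by case: k l => [[|[|[|//]]] Hk] [[|[|[|//]]] Hl]; rewrite mxE /= ?ffunE.
Qed.

Definition hom8 (s : bvec * bvec) : Q -> G :=
  dih_hom (p := p) (fun i => pi *+ s.2 i) s.1.

(** Linear independence of the two vectors over F_2; [phi8] then lists the nonzero vectors of the
    plane they span. *)
Definition S8 : {set bvec * bvec} :=
  [set s : bvec * bvec | [&& [exists i, s.1 i], [exists i, s.2 i] & [exists i, s.1 i != s.2 i]]]%SET.

Definition phi8 (s : bvec * bvec) : {set bvec} :=
  [set s.1; s.2; xorv s.1 s.2]%SET.

Lemma hom8_angle (s : bvec * bvec) i : rotx (pi *+ s.2 i *+ 2 ^ p) = 1%g.
Proof.
case: (s.2 i); last by rewrite mul0rn rotx0.
by rewrite mulr1n -(prednK p0) expnS mulrnA rotxMn rotxDpi2 expg1n.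
Qed.

Lemma hom8M s : {morph hom8 s : x y / (x * y)%g}.
Proof. exact: (dih_homM p0 _ (hom8_angle s)). Qed.

Lemma hom8_gen s i : hom8 s (gen i) = kdiag (s.1 i) (s.2 i).
Proof. exact: (dih_hom_gen p0 _ (hom8_angle s)). Qed.

Lemma conj_hom8E (s s' : bvec * bvec) (U : K) :
  (forall i, (kdiag (s.1 i) (s.2 i) ^ (rho U)^-1)%g = kdiag (s'.1 i) (s'.2 i)) ->
  conj_act U (hom8 s) = hom8 s'.
Proof.
move=> H; apply: (conj_dih_hom p0 (hom8_angle s)); first exact: hom8M.
by move=> i; rewrite hom8_gen -H.
Qed.

Lemma hom8_klein s x : klein (hom8 s x).
Proof.
move: x; apply: nil_gen_ind => [|x y|i].
- by rewrite (morph1g (hom8M s)) -kdiag1; exact: kdiag_klein.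
- move=> /klein_kdiag[a [b xE]] /klein_kdiag[c [d yE]].
  rewrite (hom8M s) (morphVg (hom8M s)) xE yE kdiagV kdiagM; exact: kdiag_klein.
- by rewrite hom8_gen; exact: kdiag_klein.
Qed.

Lemma hom8_sqr s x : (hom8 s x * hom8 s x)%g = 1%g.
Proof.
by have /klein_kdiag[a [b ->]] := hom8_klein s x; rewrite kdiagM !addbb kdiag1.
Qed.

(** The three conditions in [S8] say that none of the three nonzero linear forms on (Z/2)^2 vanishes
    on all images of generators, so these images span. *)
Lemma hom8_onto s : s \in S8 -> forall x y, exists z, hom8 s z = kdiag x y.
Proof.
rewrite inE => /and3P[/existsP[i ai] /existsP[j bj] /existsP[l ab]].
pose H x y := exists z, hom8 s z = kdiag x y.
have HM x y x' y' : H x y -> H x' y' -> H (x (+) x') (y (+) y').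
  by move=> [z zE] [z' z'E]; exists (z * z')%g; rewrite hom8M zE z'E kdiagM.
have H0 : H false false by exists 1%g; rewrite (morph1g (hom8M s)) kdiag1.
have Hg m : H (s.1 m) (s.2 m) by exists (gen m); rewrite hom8_gen.
suff [H1 H2] : H true false /\ H false true.
  by move=> [] [] //; exact: (HM true false false true).
move: (Hg i) (Hg j) (Hg l); rewrite ai bj.
case: (s.2 i) (s.1 j) (s.1 l) (s.2 l) ab => [] [] [] [] //= _ h1 h2 h3; split=> //;
  first [exact: (HM _ _ _ _ h1 h2) | exact: (HM _ _ _ _ h1 h3)].
Qed.

Lemma hom8_nontoral s : s \in S8 -> ~ toral (hom8 s).
Proof.
move=> sS tor; have [x xE] := hom8_onto sS false true.
have [y yE] := hom8_onto sS true false.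
by have := toral_no_dih tor (etrans xE (dih_rotx _)) yE; exact: rotx_pi_neq1.
Qed.

(** The Klein group is its own centraliser in SO(3): commuting with [rotx pi] preserves the first
    axis, and commuting with [flip] restricts the angle to 0 or pi. *)
Lemma hom8_stabP s (U : K) : s \in S8 -> conj_act U (hom8 s) = hom8 s <-> Q8_set U.
Proof.
move=> sS; rewrite Q8_setP; split=> [H|/klein_kdiag[x [y Uxy]]]; last first.
  by apply: conj_hom8E => i; rewrite Uxy kdiagV kdiagJ.
have HC x y : (rho U * kdiag x y = kdiag x y * rho U)%g.
  have [z <-] := hom8_onto sS x y; apply: (mulIg ((rho U)^-1)%g).
  rewrite mulgK -[in RHS]H /conj_act /conjg invgK.
  by rewrite mulgA.
apply: commute_flip_klein; last first.
  by have := HC true false; rewrite /kdiag mulr0n dih_flip.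
apply: (@commute_rotx _ _ pi pi); first exact: rotx_pi_neq1.
by have := HC false true; rewrite /kdiag mulr1n dih_rotx.
Qed.

(** A Schur-type argument. The conjugating matrix intertwines two diagonal representations, so a
    nonzero entry (k, l) forces character k of [s] to equal character l of [s']; each row of an
    orthogonal matrix has a nonzero entry. *)
Lemma conj_hom8_sub s s' (U : K) : conj_act U (hom8 s) = hom8 s' ->
  phi8 s \subset phi8 s'.
Proof.
move=> H; have chi_in t k : chi t k \in phi8 t.
  by rewrite !inE /chi; case: (k == 0); case: (k == 1); rewrite eqxx ?orbT.
have key k : exists l, chi s k = chi s' l.
  pose A := ((rho U)^-1)%g; have [r _] := SO3_orth A k k.
  have [l Al] : exists l, val A k l != 0.
    apply/existsP; case: existsP => // /forallNP A0; move: r; rewrite eqxx big1.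
      by move=> /= /eqP; rewrite eq_sym oner_eq0.
    by move=> l _; have /negP/negPn/eqP -> := A0 l; rewrite mul0r.
  exists l; apply/ffunP => i.
  have : (kdiag (s.1 i) (s.2 i) * A = A * kdiag (s'.1 i) (s'.2 i))%g.
    by rewrite -!hom8_gen -H /conj_act -/A /conjg mulVKg.
  move=> /(congr1 (fun B : G => val B k l)) /=.
  rewrite -/(val A) !mxE (bigD1 k) //= big1 => [|m mk]; last first.
    by rewrite val_kdiag eq_sym (negPf mk) mul0r.
  rewrite addr0 (bigD1 l) //= big1 => [|m mk]; last first.
    by rewrite val_kdiag (negPf mk) mulr0.
  rewrite addr0 !val_kdiag !eqxx mulrC => /(mulfI Al).
  case: (chi s k i) (chi s' l i) => [] []; rewrite // ?expr1 ?expr0; lra.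
apply/fintype.subsetP => x; rewrite !inE => /orP[/orP[]|] /eqP ->.
- by have [l] := key 0; rewrite {1}/chi /= => ->; have := chi_in s' l; rewrite !inE.
- by have [l] := key 1; rewrite {1}/chi /= => ->; have := chi_in s' l; rewrite !inE.
- by have [l] := key 2; rewrite {1}/chi /= => ->; have := chi_in s' l; rewrite !inE.
Qed.

(** The unit quaternion (1 + i + j + k)/2 permutes the three coordinate axes cyclically. *)
Lemma conj_cycle : exists U : K, forall x y, (kdiag x y ^ (rho U)^-1)%g = kdiag (x (+) y) x.
Proof.
have [|U UE] := @rho_qrot R (1 / 2) (1 / 2) (1 / 2) (1 / 2); first by field.
exists U => x y; apply: (conjg_inj (rho U)); rewrite conjgKV.
apply: (mulgI (rho U)); rewrite /conjg mulVKg; apply: val_inj.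
rewrite -[LHS]/(val (rho U) *m val (kdiag x y)).
rewrite -[RHS]/(val (kdiag (x (+) y) x) *m val (rho U)).
rewrite UE !kdiag_mx33 /qrot !mx33_mul.
by case: x y => [] []; rewrite /= ?expr0 ?expr1; congr mx33; field.
Qed.

(** A quarter-turn about the first axis exchanges the other two. *)
Lemma conj_swap : exists U : K, forall x y, (kdiag x y ^ (rho U)^-1)%g = kdiag x (x (+) y).
Proof.
have [U UE] := @rho_rotx R (pi / 2).
exists U => x y; rewrite UE -rotxN -dih_rotx dihJ expr0 mul1r.
apply: dih_eq_rotx; case: x y => [] []; rewrite /= ?subr0 //.
- by rewrite mulr1n mulr0n (_ : _ - _ = pi *+ 2) ?rotxDpi2 ?rotx0 //; field.
- by rewrite mulr0n mulr1n; congr rotx; field.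
Qed.

(** The cyclic permutation and the exchange of axes generate GL_2(F_2), which is transitive on the
    ordered bases of the plane. *)
Lemma hom8_conjP s s' : s \in S8 -> s' \in S8 ->
  (exists U : K, conj_act U (hom8 s) = hom8 s') <-> phi8 s = phi8 s'.
Proof.
move=> sS s'S; split=> [[U H]|phi].
  apply/eqP; rewrite finset.eqEsubset (conj_hom8_sub H).
  by apply: (conj_hom8_sub (U := (U^-1)%g)); rewrite -H conj_actK.
have [P HP] := conj_cycle; have [T HT] := conj_swap.
have rP a b : exists U, conj_act U (hom8 (a, b)) = hom8 (xorv a b, a).
  by exists P; apply: conj_hom8E => i; rewrite HP /= ffunE.
have rT a b : exists U, conj_act U (hom8 (a, b)) = hom8 (a, xorv a b).
  by exists T; apply: conj_hom8E => i; rewrite HT /= ffunE.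
have tr f g h : (exists U : K, conj_act U f = g) -> (exists U : K, conj_act U g = h) ->
    exists U : K, conj_act U f = h :> (Q -> G).
  by move=> [U <-] [V <-]; exists (V * U)%g; rewrite conj_actM.
have x1 a b : xorv (xorv a b) a = b.
  by apply/ffunP => i; rewrite !ffunE addbC addbA addbb.
have x2 a b : xorv a (xorv a b) = b.
  by apply/ffunP => i; rewrite !ffunE addbA addbb.
have xC a b : xorv a b = xorv b a by apply/ffunP => i; rewrite !ffunE addbC.
have sw a b : exists U, conj_act U (hom8 (a, b)) = hom8 (b, a).
  by have := tr _ _ _ (rT a b) (rP _ _); rewrite x2.
move: phi s'S sS; case: s s' => [a b] [a' b'] /setP phi.
rewrite !inE /= => /and3P[_ _ ab'] _.
have := phi a'; have := phi b'; rewrite !inE /= !eqxx orbT /=.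
have nab : a' <> b'.
  by move=> e; case/existsP: ab' => i; rewrite e eqxx.
(* Of the nine candidates for the pair, the three with equal entries are excluded; the other six are
   the ordered bases of the plane. *)
move=> /orP[/orP[]|] /eqP eb /orP[/orP[]|] /eqP ea;
  rewrite ea eb in nab *; first [by case: nab | idtac].
- exact: sw.
- exact: rP.
- by exists 1%g; rewrite conj_act1.
- by apply: tr (sw a b) _; rewrite xC; exact: rP.
- exact: rT.
- by apply: tr (sw a b) _; rewrite xC; exact: rT.
Qed.

End KleinNormalForms.

(** * Counting the conjugacy classes *)

Section Coverage.
Variables (R : realType) (n p : nat).
Hypothesis p0 : (0 < p)%N.
Local Notation K := (SU R[i] 2).
Local Notation G := (SO R 3).
Local Notation Q := (free_nilpotent n p.+1).

Lemma nontoral_conj_normal (f : Q -> G) : {morph f : x y / (x * y)%g} -> ~ toral f ->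
  (exists2 s, s \in S4 n p & exists U : K, conj_act U (hom4 R s) = f) \/
  (exists2 s, s \in S8 n & exists U : K, conj_act U (@hom8 R n p s) = f).
Proof.
move=> fM nt; have [e [[j ej] H]] := nontoral_normal_form fM nt.
have [i0 pi0 ei0] : exists2 i0, [pick i | e i] = Some i0 & e i0.
  by case: pickP => [i ei|/(_ j)]; [exists i|rewrite ej].
have [U [t [ti0 tq UE]]] := H i0 ei0.
have [k kE] := choice (fun i => rotx_zangle_onto p0 (tq i)).
pose s : {ffun 'I_n -> bool} * {ffun 'I_n -> 'Z_(2 ^ p)} := (finfun e, finfun k).
have pis : [pick i | s.1 i] = Some i0 by rewrite -pi0; apply: eq_pick => i; rewrite /= ffunE.
have ki0 : k i0 = 0 by apply: (@rotx_zangle_eq1 R p p0); rewrite -kE ti0 rotx0.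
have sn : normal4 s by rewrite /normal4 pis /= ffunE ki0.
(* If every angle is killed by 2, all angles are 0 or pi and the image lies in the Klein group. *)
have [/existsP k2|/existsPn k2] := boolP [exists i, s.2 i *+ 2 != 0].
  left; exists s; first by rewrite inE sn; apply/existsP.
  exists (U^-1)%g; suff -> : hom4 R s = conj_act U f by rewrite conj_actK.
  apply: nil_morph_ext; [exact: hom4M|exact: conj_act_morph|move=> i].
  by rewrite hom4_gen // UE !ffunE; apply: dih_eq_rotx.
have bx i : exists c : bool, rotx (t i) = rotx (pi *+ c).
  have [|->|->] := @rotx2_eq1 R (t i).
  - rewrite mulr2n rotxD kE -rotxD -mulr2n rotx_zangle_double //.
    by have := k2 i; rewrite negbK ffunE => /eqP ->; rewrite rotx_zangle0.
  - by exists false; rewrite rotx0.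
  - by exists true.
right; have [b bE] := choice bx.
pose s' : {ffun 'I_n -> bool} * {ffun 'I_n -> bool} := (finfun e, finfun b).
have fE : @hom8 R n p s' = conj_act U f.
  apply: nil_morph_ext; [exact: hom8M|exact: conj_act_morph|move=> i].
  by rewrite hom8_gen // UE !ffunE; apply: dih_eq_rotx.
exists s'; last by exists (U^-1)%g; rewrite fE conj_actK.
(* At [i0] the pair of signs is (true, false), which shows that the first vector is nonzero and
   differs from the second. *)
have bi0 : b i0 = false.
  have := bE i0; rewrite ti0 rotx0; case: (b i0) => // /esym.
  by move=> /rotx_pi_neq1.
rewrite inE; apply/and3P; split.
- by apply/existsP; exists i0; rewrite ffunE.
(* With all angles 0 the image lies in {1, [flip]}, hence in the torus around the axis of [flip]. *)
- apply/existsP/not_existsP => nb; apply: nt; apply: (@toral_conj _ _ U).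
  have [V [u Vu]] := SO3_axis (flip R).
  exists (V^-1)%g => x; rewrite -fE /conj_act rhoV invgK.
  suff [c ->] : exists c : bool, @hom8 R n p s' x = (flip R ^+ c)%g.
    by case: c; rewrite ?expg1 ?Vu ?expg0 ?conj1g mxE.
  move: x; apply: nil_gen_ind => [|x y [c xc] [d yd]|i].
  + by exists false; rewrite (morph1g (@hom8M R n p p0 s')).
  + exists (c (+) d); rewrite (@hom8M R n p p0) (morphVg (@hom8M R n p p0 s')) xc yd.
    by case: c d {xc yd} => [] []; rewrite ?expg1 ?expg0 ?flipV ?invg1 ?flip2 ?mulg1 ?mul1g.
  + exists (e i); rewrite hom8_gen // !ffunE; have /negP/negPf := nb i.
    by rewrite ffunE /kdiag /dih => ->; rewrite rotx0 mul1g.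
- by apply/existsP; exists i0; rewrite !ffunE ei0 bi0.
Qed.

End Coverage.

Section Counting.

Lemma card_uniform_fibers (T V : finType) (S : {set T}) (phi : T -> V) c :
  (forall s, s \in S -> #|[set t in S | phi t == phi s]%SET| = c) ->
  #|S| = (#|(phi @: S)%SET| * c)%N.
Proof.
move=> H; rewrite -sum1_card (partition_big phi (mem (phi @: S)%SET)) /=; last first.
  by move=> s sS; exact: imset_f.
rewrite -[in RHS]sum1_card big_distrl; apply: eq_bigr => _ /imsetP[s sS ->].
rewrite [RHS]mul1n -(H s sS) -sum1_card; apply: eq_bigl => t.
by rewrite inE.
Qed.

(** One representative per conjugacy class, indexed by the ordinals that index the summands of
    [copies]. *)
Lemma imset_reps (T V : finType) (S : {set T}) (phi : T -> V) m :
  #|(phi @: S)%SET| = m -> exists r : 'I_m -> T,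
  [/\ forall i, r i \in S, forall i j, phi (r i) = phi (r j) -> i = j
    & forall s, s \in S -> exists i, phi (r i) = phi s].
Proof.
move=> <-; have H (i : 'I_#|(phi @: S)%SET|) : exists t, t \in S /\ phi t = enum_val i.
  by have /imsetP[t tS ->] := enum_valP i; exists t.
have [r rP] := choice H; exists r; split=> [i|i j|s sS].
- by have [] := rP i.
- by have [_ ->] := rP i; have [_ ->] := rP j; exact: enum_val_inj.
- have sI : phi s \in (phi @: S)%SET by exact: imset_f.
  exists (enum_rank_in sI (phi s)).
  by have [_ ->] := rP (enum_rank_in sI (phi s)); rewrite enum_rankK_in.
Qed.

Variable n : nat.
Local Notation bvec := {ffun 'I_n -> bool}.
Local Notation zerov := [ffun=> false].

Lemma bvec_nonzero (a : bvec) : [exists i, a i] = (a != zerov).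
Proof.
apply/existsP/idP => [[j]|]; first by apply: contraTneq => ->; rewrite ffunE.
apply: contraNP => /forallNP H; apply/eqP/ffunP => i; rewrite ffunE.
by apply/negbTE/negP; exact: H.
Qed.

Lemma bvec_neq (a b : bvec) : [exists i, a i != b i] = (a != b).
Proof.
apply/existsP/idP => [[j]|]; first by apply: contraNneq => ->.
apply: contraNP => /forallNP H; apply/eqP/ffunP => i.
by apply/eqP/negPn/negP; exact: H.
Qed.

Lemma card_bvec : #|{: bvec}| = (2 ^ n)%N.
Proof. by rewrite card_ffun card_bool card_ord. Qed.

Lemma in_S8 (s : bvec * bvec) :
  (s \in S8 n) = [&& s.1 != zerov, s.2 != zerov & s.1 != s.2].
Proof. by rewrite inE !bvec_nonzero bvec_neq. Qed.

Lemma card_S8 : #|S8 n| = ((2 ^ n - 1) * (2 ^ n - 2))%N.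
Proof.
rewrite -sum1_card.
rewrite (eq_bigl (fun s : bvec * bvec => (s.1 != zerov) && ((s.2 != zerov) && (s.2 != s.1)))); last first.
  by move=> s; rewrite in_S8 [s.2 == s.1]eq_sym.
rewrite -(pair_big_dep (fun a : bvec => a != zerov)
  (fun a b : bvec => (b != zerov) && (b != a)) (fun _ _ => 1%N)) /=.
rewrite (eq_bigr (fun=> 2 ^ n - 2)%N) => [|a a0].
  rewrite sum_nat_const; congr (_ * _)%N.
  by rewrite -card_bvec subn1 -(cardC1 (zerov : bvec)).
rewrite sum1_card -card_bvec.
have -> : #|[pred b : bvec | (b != zerov) && (b != a)]| = #|(~: [set (zerov : bvec); a])%SET|.
  by apply: eq_card => b; rewrite !inE negb_or.
by rewrite cardsCs finset.setCK cards2 eq_sym a0.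
Qed.

Lemma card_phi8 (s : bvec * bvec) : s \in S8 n -> #|phi8 s| = 3.
Proof.
rewrite in_S8 => /and3P[a0 b0 ab].
rewrite /phi8 -finset.setUA cardsU1 cards2 !inE negb_or ab.
have -> : s.1 != xorv s.1 s.2.
  apply: contra b0 => /eqP/ffunP H; apply/eqP/ffunP => i.
  by have := H i; rewrite !ffunE; case: (s.1 i) (s.2 i) => [] [].
have -> // : s.2 != xorv s.1 s.2.
apply: contra a0 => /eqP/ffunP H; apply/eqP/ffunP => i.
by have := H i; rewrite !ffunE; case: (s.1 i) (s.2 i) => [] [].
Qed.

(** Any two distinct nonzero vectors of a plane over F_2 span it and have the third as their sum, so
    the fibre consists of the ordered pairs of distinct elements of [phi8 s]. *)
Lemma phi8_fiber (s t : bvec * bvec) : s \in S8 n ->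
  (t \in S8 n) && (phi8 t == phi8 s) = (t.1 \in phi8 s) && (t.2 \in phi8 s :\ t.1)%SET.
Proof.
move=> sS; apply/andP/andP => [[tS /eqP <-]|].
  by move: tS; rewrite in_S8 !inE !eqxx ?orbT => /and3P[_ _]; rewrite eq_sym => ->.
case: s t sS => [a b] [x y] sS; rewrite [_ :\ _]lock !inE -lock /= => -[xD].
rewrite !inE /= => /andP[yx yD].
move: (sS); rewrite in_S8 /= => /and3P[a0 b0 ab].
have xC : forall u v : bvec, xorv u v = xorv v u.
  by move=> u v; apply/ffunP => i; rewrite !ffunE addbC.
have x1 : forall u v : bvec, xorv u (xorv u v) = v.
  by move=> u v; apply/ffunP => i; rewrite !ffunE addbA addbb.
have x2 : forall u v : bvec, xorv (xorv v u) u = v.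
  by move=> u v; rewrite xC (xC v) x1.
have xor0 : xorv a b != zerov.
  apply: contra ab => /eqP/ffunP H; apply/eqP/ffunP => i.
  by have := H i; rewrite !ffunE; case: (a i) (b i) => [] [].
have tS : (x, y) \in S8 n.
  rewrite in_S8 /= [x == y]eq_sym yx andbT.
  by case/orP: xD => [/orP[]|] /eqP ->; case/orP: yD => [/orP[]|] /eqP ->; apply/andP.
have xyD : xorv x y \in phi8 (a, b).
  rewrite !inE /=; case/orP: xD yx => [/orP[]|] /eqP ->;
    case/orP: yD => [/orP[]|] /eqP ->; rewrite ?eqxx //= => _.
  - by rewrite !orbT.
  - by rewrite x1 eqxx !orbT.
  - by rewrite (xC b a) eqxx !orbT.
  - by rewrite (xC a b) x1 eqxx.
  - by rewrite xC x1 eqxx !orbT.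
  - by rewrite x2 eqxx.
split; first by move: tS; rewrite inE.
rewrite finset.eqEcard (card_phi8 tS) (card_phi8 sS) leqnn andbT.
apply/fintype.subsetP => u; rewrite {1}/phi8 !inE /= => /orP[/orP[]|] /eqP -> //.
by move: xyD; rewrite !inE.
Qed.

(** 6 = 3 * 2 is the number of ordered bases of a plane over F_2. *)
Lemma card_phi8_image : (#|(@phi8 n @: S8 n)%SET| * 6 = (2 ^ n - 1) * (2 ^ n - 2))%N.
Proof.
rewrite -card_S8 -(@card_uniform_fibers _ _ _ (@phi8 n) 6) // => s sS.
rewrite -sum1_card.
rewrite (eq_bigl (fun t : bvec * bvec => (t.1 \in phi8 s) && (t.2 \in phi8 s :\ t.1)%SET)); last first.
  by move=> t; rewrite inE phi8_fiber.
rewrite -(pair_big_dep (fun x : bvec => x \in phi8 s)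
  (fun x y : bvec => y \in phi8 s :\ x)%SET (fun _ _ => 1%N)) /=.
rewrite (eq_bigr (fun=> 2%N)) => [|x xD].
  by rewrite sum_nat_const card_phi8.
by rewrite sum1_card; have := cardsD1 x (phi8 s); rewrite card_phi8 // xD => -[].
Qed.

End Counting.

Lemma double_nb_Q8 n : (0 < n)%N ->
  ((2 ^ n - 1) * (2 ^ n - 2) = (2 ^ n - 1) * (2 ^ (n - 1) - 1) * 2)%N.
Proof.
case: n => // n _; rewrite subSS subn0 -mulnA; congr (_ * _)%N.
by rewrite mulnBl -expnSr mul1n.
Qed.

Lemma card_phi8_nb n : (0 < n)%N -> #|(@phi8 n @: S8 n)%SET| = nb_Q8 n.
Proof.
move=> n0; have := card_phi8_image n; rewrite double_nb_Q8 // (mulnA _ 3 2).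
move=> /eqP; rewrite eqn_pmul2r // => /eqP e.
by rewrite /nb_Q8 -e mulnK.
Qed.

Section CountingDihedral.
Variables n p : nat.
Hypothesis p0 : (0 < p)%N.
Local Notation N := (2 ^ p)%N.
Local Notation bvec := {ffun 'I_n -> bool}.
Local Notation zvec := {ffun 'I_n -> 'Z_N}.

Lemma card_ffun_vanish (T : finType) (P : pred T) (x : T) (i0 : 'I_n) : P x ->
  #|[pred f : {ffun 'I_n -> T} | (f i0 == x) && [forall i, P (f i)]]| = (#|P| ^ n.-1)%N.
Proof.
move=> Px; pose F (i : 'I_n) : pred T := if i == i0 then (pred1 x : pred T) else P.
transitivity #|(family F : simpl_pred {ffun 'I_n -> T})|.
  apply: eq_card => f; rewrite !inE; apply/andP/familyP => [[/eqP f0 /forallP Pf] i|H].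
    by rewrite /F; case: eqP => [->|_]; rewrite unfold_in /= ?f0 //; exact: Pf.
  have f0 : f i0 = x by have := H i0; rewrite /F eqxx unfold_in /= => /eqP.
  split; first by rewrite f0.
  by apply/forallP => i; have := H i; rewrite /F; case: eqP => // ->; rewrite f0.
rewrite card_family /image_mem.
have -> : foldr muln 1%N [seq #|F i| | i <- enum 'I_n] = (\prod_(i : 'I_n) #|F i|)%N.
  by rewrite foldrE big_map big_enum.
rewrite (bigD1 i0) //= {1}/F eqxx card1 mul1n (eq_bigr (fun=> #|P|)); last first.
  by move=> i /negPf ni; rewrite /F ni.
by rewrite prod_nat_const cardC1 card_ord.
Qed.

(** The 2-torsion of Z/2^p is {0, 2^(p-1)}. *)
Lemma Zp_double_eq0 (k : 'Z_N) : (k *+ 2 == 0) = (k == 0) || (k == inord (2 ^ p.-1)).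
Proof.
have NE := Z2p_cast p0; have N2 : (2 ^ p.-1 * 2 = N)%N by rewrite -expnSr prednK.
have kN : (k < N)%N by rewrite -[X in (_ < X)%N]NE.
have e2 : (inord (2 ^ p.-1) : 'Z_N) = (2 ^ p.-1)%N :> nat.
  by rewrite inordK // NE -N2 muln2 -addnn -[X in (X < _)%N]addn0 ltn_add2l expn_gt0.
have e1 : (k *+ 2 == 0) = (N %| k + k)%N.
  rewrite mulr2n -val_eqE /= /dvdn.
  by have -> : forall m, (m %% (Zp_trunc N).+2 = m %% N)%N by rewrite NE.
rewrite e1 addnn -muln2 -[X in (X %| _)%N]N2 dvdn_pmul2r // -!val_eqE /= e2.
apply/idP/orP => [/dvdnP[m mE]|[]/eqP ->]; last first.
- exact: dvdnn.
- exact: dvdn0.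
have : (m < 2)%N by rewrite -(ltn_pmul2r (expn_gt0 2 p.-1)) -mE mulnC N2.
by case: m mE => [|[|//]] ->; [left|right; rewrite mul1n].
Qed.

Lemma card_Zp_double0 : #|[pred k : 'Z_N | k *+ 2 == 0]| = 2.
Proof.
transitivity #|[set (0 : 'Z_N); inord (2 ^ p.-1)]%SET|.
  by apply: eq_card => k; rewrite !inE Zp_double_eq0.
rewrite cards2; have -> // : (0 : 'Z_N) != inord (2 ^ p.-1).
rewrite eq_sym -val_eqE /= inordK; first by rewrite -lt0n expn_gt0.
by rewrite Z2p_cast // ltn_exp2l // ltn_predL.
Qed.

(** For each nonzero sign vector, the angle vanishes at the first reversing index and is free at the
    n - 1 others; the 2^(n-1) vectors made of 2-torsion are removed. *)
Lemma card_S4 : #|S4 n p| = ((2 ^ n - 1) * (N ^ n.-1 - 2 ^ n.-1))%N.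
Proof.
pose P (a : bvec) (k : zvec) := oapp (fun i => k i == 0) false [pick i | a i].
rewrite -sum1_card.
rewrite (eq_bigl (fun s : bvec * zvec => (s.1 != [ffun=> false]) &&
  (P s.1 s.2 && [exists i, s.2 i *+ 2 != 0]))); last first.
  move=> s; rewrite inE /normal4 -bvec_nonzero /P; case: pickP => /= [i si|H].
    by have -> : [exists i, s.1 i] by apply/existsP; exists i.
  by rewrite andbF.
rewrite -(pair_big_dep (fun a : bvec => a != [ffun=> false])
  (fun (a : bvec) (k : zvec) => P a k && [exists i, k i *+ 2 != 0]) (fun _ _ => 1%N)) /=.
rewrite (eq_bigr (fun=> N ^ n.-1 - 2 ^ n.-1)%N) => [|a a0].
  rewrite sum_nat_const; congr (_ * _)%N.
  by rewrite -card_bvec subn1 -(cardC1 ([ffun=> false] : bvec)).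
rewrite sum1_card.
have [i0 pi0] : exists i0, [pick i | a i] = Some i0.
  by move: a0; rewrite -bvec_nonzero; case: pickP => [j _ _|H /existsP[j]]; [exists j|rewrite H].
have c1 := @card_ffun_vanish 'Z_N predT 0 i0 isT.
have c2 := @card_ffun_vanish 'Z_N [pred k | k *+ 2 == 0] 0 i0 (eqxx _).
rewrite card_Zp_double0 in c2.
have cT : #|(predT : pred 'Z_N)| = N by rewrite card_ord Z2p_cast.
rewrite cT in c1; rewrite -c1 -c2.
have fT (k : zvec) : [forall i, predT (k i)] by apply/forallP.
set c := (X in X = _); set A := (X in (X - _)%N); set B := (X in (_ - X)%N).
(* A counts all vectors vanishing at [i0], B the 2-torsion ones among them, and c the remaining
   ones. *)
suff -> : A = (B + c)%N by rewrite addKn.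
rewrite /A -(cardID [pred k : zvec | [forall i, k i *+ 2 == 0]]).
congr (_ + _)%N; apply: eq_card => k; rewrite !inE fT andbT //.
by rewrite /P pi0 /= negb_forall andbC.
Qed.

(** The fibre is [s] together with its opposite; they differ because some angle is not 2-torsion,
    and negation keeps the zero at the normalised index. *)
Lemma phi4_fiber s : s \in S4 n p ->
  #|[set t in S4 n p | phi4 t == phi4 s]%SET| = 2.
Proof.
move=> sS; have [sn [i si]] := S4P sS.
transitivity #|[set s; (s.1, - s.2)]%SET|; last first.
  rewrite cards2; have -> // : s != (s.1, - s.2).
  apply: contra_notN si => /eqP/(congr1 snd) /= /ffunP/(_ i); rewrite ffunE => e.
  by rewrite mulr2n {1}e addNr.
apply: eq_card => t; rewrite !inE; apply/andP/orP => [[_ /eqP[e1 /setP /(_ t.2)]]|].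
  rewrite !inE eqxx /= => /esym/orP[]/eqP e2; [left|right];
    by rewrite [t]surjective_pairing e1 e2 // -surjective_pairing.
case=> /eqP ->; first by split=> //; move: sS; rewrite inE.
split; last by rewrite /phi4 /= opprK finset.setUC.
have [i0 [pi0 _ si0]] := normal4P sn.
rewrite /normal4 /= pi0 /= ffunE si0 oppr0 eqxx /=.
apply/existsP; exists i; rewrite ffunE mulNrn oppr_eq0; exact/eqP.
Qed.

Lemma card_phi4_nb : (1 < n)%N -> #|(@phi4 n p @: S4 n p)%SET| = nb_mu4 n p.+1.
Proof.
move=> n1; apply/eqP; rewrite -(eqn_pmul2r (isT : 0 < 2)%N); apply/eqP.
rewrite -(card_uniform_fibers phi4_fiber) card_S4 /nb_mu4.
rewrite -!mulnA -expnSr; congr (_ * _)%N.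
(* The factor 2 of the fibres turns 2^(n-2) into 2^(n-1), which is then distributed over the
   difference. *)
have -> : (n - 2).+1 = n.-1 by case: n n1 => [|[|m]] //= _; rewrite !subSS subn0.
rewrite mulnBl mul1n -expnD -expnM; congr (2 ^ _ - _)%N.
by rewrite subSS !subn1 -{1}(prednK p0) mulSnr.
Qed.

End CountingDihedral.

(** * Topology *)

Section GeneralTopology.

Lemma compact_hausdorff_homeomorphic (X Y : topologicalType) (f : X -> Y) :
  compact [set: X] -> hausdorff_space Y -> continuous f ->
  injective f -> (forall y, exists x, f x = y) -> homeomorphic Y X.
Proof.
move=> cX hY cf finj fsurj; have [g gP] := choice fsurj.
have gK : cancel g f by exact: gP.
have fK : cancel f g by move=> x; apply: finj; rewrite gK.
exists g, f; split=> //; apply/continuous_closedP => A cA.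
have -> : g @^-1` A = f @` A.
  apply/seteqP; split=> [y gy|_ [x Ax <-]]; first by exists (g y).
  by rewrite /preimage /= fK.
apply: compact_closed => //; apply: continuous_compact.
  exact: continuous_subspaceT.
exact: subclosed_compact cA cX _.
Qed.

Lemma closed_equalizer (X Y : topologicalType) (f g : X -> Y) :
  hausdorff_space Y -> continuous f -> continuous g -> closed [set x | f x = g x].
Proof.
move=> hY cf cg p pE; apply: hY => A B fA gB.
have : nbhs p (f @^-1` A `&` g @^-1` B) by apply: filterI; [exact: cf|exact: cg].
move=> /pE[x [/= fg [Afx Bgx]]]; exists (f x); split=> //.
by rewrite fg.
Qed.

Lemma hausdorff_set_type (X : topologicalType) (A : set X) :
  hausdorff_space X -> hausdorff_space (set_type A).
Proof.
move=> hX p q pq; apply: val_inj; apply: hX => B D pB qD.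
have cv : continuous (val : set_type A -> X) by exact: initial_continuous.
by have [z [Bz Dz]] := pq _ _ (cv p B pB) (cv q D qD); exists (val z).
Qed.

Lemma compact_set_type (X : topologicalType) (A : set X) :
  compact A -> compact [set: set_type A].
Proof.
move=> cA F FF _; pose v : set_type A -> X := val.
(* The filter is pushed forward to the ambient space, where compactness of [A] gives a cluster point
   inside [A]. *)
have [p [Ap Fp]] := cA (v @ F) _ (filterS (fun x _ => set_valP x) filterT).
exists (exist (fun x => x \in A) p (mem_set Ap)); split=> // B N FB.
rewrite nbhsE => -[D [[/= E oE <-] Ep] DN].
have FvB : F (v @^-1` (v @` B)) by apply: filterS FB => x Bx; exists x.
have /Fp H : (v @ F) (v @` B) by exact: FvB.
have nE : nbhs p E by apply: open_nbhs_nbhs.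
by have [_ [[x Bx <-] Ex]] := H _ nE; exists x; split=> //; exact: DN.
Qed.

Lemma set_type_continuous (X Y : topologicalType) (A : set Y) (f : X -> set_type A) :
  continuous (val \o f) -> continuous f.
Proof. exact: continuous_comp_initial. Qed.

Lemma set_val_continuous (X : topologicalType) (A : set X) :
  continuous (val : set_type A -> X).
Proof. exact: initial_continuous. Qed.

Lemma ptws_continuous (X V : topologicalType) (I : eqType) (f : X -> {ptws I -> V}) :
  (forall i, continuous (fun x => f x i)) -> continuous f.
Proof.
move=> cf x; apply/cvg_sup => i.
exact: (@continuous_comp_initial _ _ _ (fun g : I -> V => g i) _ (cf i) x).
Qed.

Lemma ptws_proj_continuous (V : topologicalType) (I : eqType) (i : I) :
  continuous (fun f : {ptws I -> V} => f i).
Proof. exact: (@proj_continuous I (fun=> V)). Qed.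

Lemma mulg_fun_continuous (X : topologicalType) (G : topologicalGroupType) (f g : X -> G) :
  continuous f -> continuous g -> continuous (fun x => (f x * g x)%g).
Proof.
move=> cf cg x; apply: (@continuous_comp _ _ _
  (fun x => (f x, g x)) (fun q : G * G => q.1 * q.2)%g); last exact: mulg_continuous.
have F1 := nbhs_filter (f x); have F2 := nbhs_filter (g x).
by apply: (cvg_pair (G := nbhs (f x)) (H := nbhs (g x))); [exact: cf|exact: cg].
Qed.

Lemma invg_fun_continuous (X : topologicalType) (G : topologicalGroupType) (f : X -> G) :
  continuous f -> continuous (fun x => (f x)^-1)%g.
Proof.
move=> cf x; apply: (@continuous_comp _ _ _ f (fun y : G => y^-1)%g); first exact: cf.
exact: invg_continuous.
Qed.

Lemma hom_space_closed (T : groupType) (G : topologicalGroupType) :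
  hausdorff_space G -> closed (@hom_space T G).
Proof.
move=> hG; have -> : @hom_space T G = \bigcap_(xy : T * T)
    [set f : {ptws T -> G} | f (xy.1 * xy.2)%g = (f xy.1 * f xy.2)%g].
  by apply/seteqP; split=> [f fM [x y] _ //|f fM x y]; exact: (fM (x, y)).
apply: closed_bigI => -[x y] _; apply: closed_equalizer => //=.
  exact: ptws_proj_continuous.
by apply: mulg_fun_continuous; exact: ptws_proj_continuous.
Qed.

(** A component of a closed set is closed, and the ambient product is compact by Tychonoff. *)
Lemma hom_component_compact (T : groupType) (G : topologicalGroupType) :
  hausdorff_space G -> compact [set: G] -> compact [set: set_type (@hom_component T G)].
Proof.
move=> hG cG; apply: compact_set_type.
have cP : compact [set: {ptws T -> G}].
  by have := @tychonoff T (fun=> G) (fun=> setT) (fun=> cG); congr compact; apply/seteqP; split.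
apply: subclosed_compact cP _ => //.
exact: component_closed (hom_space_closed hG).
Qed.

Lemma coset_space_compact (G : topologicalGroupType) (H : groupClosed G) :
  compact [set: G] -> compact [set: coset_space H].
Proof.
move=> cG; have -> : [set: coset_space H] = \pi_(coset_space H) @` [set: G].
  by apply/seteqP; split=> // c _; exists (repr c) => //; exact: reprK.
apply: continuous_compact => //; apply: continuous_subspaceT; exact: pi_continuous.
Qed.

End GeneralTopology.

(** * Continuity of real and imaginary parts *)

Section ComplexTopology.
Variable R : realType.
Local Notation C := (R[i] : numClosedFieldType).

Lemma real_complex_norm (r : R) : `|r%:C%C : R[i]| = `|r|%:C%C :> R[i].
Proof. by rewrite normc_def /= expr0n /= addr0 sqrtr_sqr. Qed.

Lemma real_complex_continuous : continuous (fun r : R => r%:C%C : C).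
Proof.
(* Radii of balls in C are complex numbers; e > 0 makes e real, so its real part serves as radius in
   R. *)
move=> r A /nbhs_ballP[e /= e0 eA]; apply/nbhs_ballP; exists (complex.Re e).
  by move: e0; rewrite ltcE /= => /andP[].
move=> s; rewrite -ball_normE /= => rs; apply: eA.
rewrite -ball_normE /= -rmorphB /= real_complex_norm ltcE /= rs andbT.
by move: e0; rewrite ltcE /= => /andP[].
Qed.

Lemma Re_continuous : continuous (@complex.Re R : C -> R).
Proof.
move=> z A /nbhs_ballP[e /= e0 eA]; apply/nbhs_ballP; exists (e%:C)%C.
  by rewrite /= ltcR.
move=> w; rewrite /ball_ /= normc_def ltcR => zw; apply: eA.
rewrite -ball_normE /=; apply: le_lt_trans zw; case: z w => [a b] [c d] /=.
by rewrite -sqrtr_sqr ler_wsqrtr // lerDl sqr_ge0.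
Qed.

Lemma Im_continuous : continuous (@complex.Im R : C -> R).
Proof.
move=> z A /nbhs_ballP[e /= e0 eA]; apply/nbhs_ballP; exists (e%:C)%C.
  by rewrite /= ltcR.
move=> w; rewrite /ball_ /= normc_def ltcR => zw; apply: eA.
rewrite -ball_normE /=; apply: le_lt_trans zw; case: z w => [a b] [c d] /=.
by rewrite -sqrtr_sqr ler_wsqrtr // lerDr sqr_ge0.
Qed.

Lemma complex_continuous (X : topologicalType) (f g : X -> R) :
  continuous f -> continuous g -> continuous (fun x => (f x +i* g x)%C : C).
Proof.
move=> cf cg; have -> : (fun x => (f x +i* g x)%C : C) =
    (fun x => (f x)%:C%C + 'i * (g x)%:C%C : C).
  by apply/funext => x; apply/eqP; rewrite eq_complex /=; apply/andP; split; apply/eqP; ring.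
have cC (h : X -> R) : continuous h -> continuous (fun x => (h x)%:C%C : C).
  move=> ch x; apply: (@continuous_comp _ _ _ h (fun r : R => r%:C%C : C)); first exact: ch.
  exact: real_complex_continuous.
move=> x; apply: (@cvgD C); first exact: cC.
by apply: (@cvgM C); [exact: cvg_cst|exact: cC].
Qed.

End ComplexTopology.

(** * Continuity of the cover, compactness of SU(2) and SO(3) *)

Section DoubleCoverTopology.
Variable R : realType.
Local Notation C := (R[i] : numClosedFieldType).
Local Notation K := (SU C 2).
Local Notation G := (SO R 3).

Lemma hausdorff_SO : hausdorff_space G.
Proof. by apply: hausdorff_set_type; exact: norm_hausdorff. Qed.

Lemma mx33_continuous (X : topologicalType) (a b c d e f g h i : X -> R) :
  continuous a -> continuous b -> continuous c -> continuous d -> continuous e ->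
  continuous f -> continuous g -> continuous h -> continuous i ->
  continuous (fun x => mx33 (a x) (b x) (c x) (d x) (e x) (f x) (g x) (h x) (i x)).
Proof.
move=> ca cb cc cd ce cf cg ch ci; apply: continuous_mx.
by move=> -[[|[|[|//]]] Hk] [[|[|[|//]]] Hl]; under eq_fun do rewrite mxE /=.
Qed.

Lemma oppr_fun_continuous (X : topologicalType) (u : X -> R) :
  continuous u -> continuous (fun x => - u x).
Proof. by move=> cu x; apply: cvgN; exact: cu. Qed.

Lemma addr_fun_continuous (X : topologicalType) (u v : X -> R) :
  continuous u -> continuous v -> continuous (fun x => u x + v x).
Proof. by move=> cu cv x; apply: cvgD; [exact: cu|exact: cv]. Qed.

Lemma mulr_fun_continuous (X : topologicalType) (u v : X -> R) :
  continuous u -> continuous v -> continuous (fun x => u x * v x).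
Proof. by move=> cu cv x; apply: cvgM; [exact: cu|exact: cv]. Qed.

Lemma qrot_continuous (X : topologicalType) (a b c d : X -> R) :
  continuous a -> continuous b -> continuous c -> continuous d ->
  continuous (fun x => qrot (a x) (b x) (c x) (d x)).
Proof.
move=> ca cb cc cd.
have c2 (u : X -> R) : continuous u -> continuous (fun x => 2 * u x).
  by move=> cu; apply: mulr_fun_continuous => // x; exact: cvg_cst.
have cX (u : X -> R) : continuous u -> continuous (fun x => u x ^+ 2).
  by move=> cu; exact: mulr_fun_continuous.
have cD := @addr_fun_continuous X; have cM := @mulr_fun_continuous X.
have cB (u v : X -> R) : continuous u -> continuous v -> continuous (fun x => u x - v x).
  by move=> cu cv; apply: cD => //; exact: oppr_fun_continuous.
have sum4 (u v w z : X -> R) : continuous u -> continuous v -> continuous w ->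
    continuous z -> continuous (fun x => u x + v x + w x + z x).
  by move=> cu cv cw cz; apply: (cD _ z) => //; apply: (cD _ w) => //; exact: cD.
apply: mx33_continuous; first
  [ by apply: sum4; first [exact: cX | by apply: oppr_fun_continuous; exact: cX]
  | by apply: c2; first [by apply: cB; exact: cM | by apply: cD; exact: cM]].
Qed.

Lemma rho_continuous : continuous (@rho R).
Proof.
apply: set_type_continuous.
have cU i j : continuous (fun U : K => val U i j).
  move=> U; apply: (@continuous_comp _ _ _ (val : K -> 'M[C]_2) (fun M : 'M[C]_2 => M i j)).
    exact: set_val_continuous.
  exact: coord_continuous.
have cRe i j : continuous (fun U : K => complex.Re (val U i j)).
  move=> U; apply: (@continuous_comp _ _ _ (fun U : K => val U i j) (@complex.Re R : C -> R)).
    exact: cU.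
  exact: Re_continuous.
have cIm i j : continuous (fun U : K => complex.Im (val U i j)).
  move=> U; apply: (@continuous_comp _ _ _ (fun U : K => val U i j) (@complex.Im R : C -> R)).
    exact: cU.
  exact: Im_continuous.
apply: qrot_continuous; [exact: cRe|exact: cIm|exact: cRe|].
by apply: oppr_fun_continuous; exact: cIm.
Qed.

Lemma rho_onto (A : G) : exists U : K, rho U = A.
Proof.
have [U [t At]] := SO3_axis A; have [V VE] := rho_rotx t.
exists (U * V * U^-1)%g; rewrite !rhoM rhoV VE -At /conjg.
by rewrite mulVKg mulgK.
Qed.

(** SU(2) is the continuous image of the unit sphere of R^4 under [qmx]. *)
Lemma compact_SU2 : compact [set: K].
Proof.
pose S3 : set 'rV[R]_4 := [set v | v 0 0 ^+ 2 + v 0 1 ^+ 2 + v 0 2 ^+ 2 + v 0 3 ^+ 2 = 1].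
have c_ i : continuous (fun v : 'rV[R]_4 => v 0 i) by exact: coord_continuous.
have cS : compact S3.
  apply: bounded_closed_compact.
    exists 1; split=> // M M1 v vS.
    rewrite /= /Num.Def.normr /= mx_normrE; apply/bigmax_leP; split=> [|[i j] _ /=].
      by rewrite ltW // (lt_trans ltr01).
    rewrite ord1; apply: le_trans (ltW M1).
    have vj : v 0 j ^+ 2 <= 1.
      rewrite -vS; have h k := sqr_ge0 (v 0 k).
      have := h 0; have := h 1; have := h 2; have := h 3.
      case: j => [[|[|[|[|//]]]] Hj].
      - rewrite (_ : Ordinal Hj = 0); [lra|exact: val_inj].
      - rewrite (_ : Ordinal Hj = 1); [lra|exact: val_inj].
      - rewrite (_ : Ordinal Hj = 2); [lra|exact: val_inj].
      - rewrite (_ : Ordinal Hj = 3); [lra|exact: val_inj].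
    by rewrite ler_norml; apply/andP; split; nra.
  apply: closed_equalizer; first exact: Rhausdorff.
    apply: addr_fun_continuous; last exact: mulr_fun_continuous.
    apply: addr_fun_continuous; last exact: mulr_fun_continuous.
    by apply: addr_fun_continuous; exact: mulr_fun_continuous.
  exact: cst_continuous.
pose f (v : set_type S3) : K := exist (fun M => M \in SU_set C 2) _ (qmx_SU (set_valP v)).
have -> : [set: K] = f @` [set: set_type S3].
  apply/seteqP; split=> // U _; have [a [b [c [d [h UE]]]]] := SU_qmx U.
  pose v : 'rV[R]_4 := \row_i nth 0 [:: a; b; c; d] i.
  have vS : S3 v by rewrite /S3 /= !mxE.
  exists (exist (fun x => x \in S3) v (mem_set vS)) => //.
  by apply: val_inj; rewrite UE /= !mxE.
apply: continuous_compact; last exact: compact_set_type.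
apply: continuous_subspaceT; apply: set_type_continuous.
have cv i : continuous (fun v : set_type S3 => val v 0 i).
  move=> v; apply: (@continuous_comp _ _ _ (val : set_type S3 -> 'rV[R]_4) (fun v => v 0 i)).
    exact: set_val_continuous.
  exact: c_.
have cN i := oppr_fun_continuous (cv i).
apply: continuous_mx => -[[|[|//]] Hi] [[|[|//]] Hj]; under eq_fun do rewrite mxE /=;
  by apply: complex_continuous.
Qed.

Lemma compact_SO3 : compact [set: G].
Proof.
have -> : [set: G] = @rho R @` [set: K].
  by apply/seteqP; split=> // A _; have [U <-] := rho_onto A; exists U.
apply: continuous_compact; last exact: compact_SU2.
apply: continuous_subspaceT; exact: rho_continuous.
Qed.

Lemma conj_act_continuous (T : eqType) (f : T -> G) :
  continuous (fun U : K => conj_act U f : {ptws T -> G}).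
Proof.
have cr := invg_fun_continuous rho_continuous.
apply: ptws_continuous => x; rewrite /conj_act /conjg; apply: mulg_fun_continuous.
  exact: invg_fun_continuous.
by apply: mulg_fun_continuous => //; exact: cst_continuous.
Qed.

End DoubleCoverTopology.

(** * Toral homomorphisms *)

Section FreeAbelianQuotient.
Variables n p : nat.
Hypothesis p0 : (0 < p)%N.
Local Notation Q := (free_nilpotent n p.+1).

Definition zn_gen (i : 'I_n) : Zn n := (delta_mx 0 i : 'rV[int]_n).

Lemma zn_mulE (x y : Zn n) : (x * y)%g = (x + y : 'rV[int]_n) :> 'rV[int]_n.
Proof. by []. Qed.

Lemma zn_mulC (x y : Zn n) : (x * y = y * x)%g.
Proof. exact: addrC. Qed.

Lemma zn_ind (P : Zn n -> Prop) : P 1%g ->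
  (forall x y, P x -> P y -> P (x / y)%g) -> (forall i, P (zn_gen i)) ->
  forall x, P x.
Proof.
move=> P1 PM Pg.
have PV x : P x -> P (x^-1)%g by move=> Px; rewrite -[(x^-1)%g]mul1g; exact: PM.
have PD x y : P x -> P y -> P (x * y)%g.
  by move=> Px /PV Py; rewrite -[y]invgK; exact: PM.
move=> x; rewrite [x](row_sum_delta (x : 'rV[int]_n)).
apply: (big_ind (P : 'rV[int]_n -> Prop)) => // i _.
have Pn m : P (zn_gen i ^+ m)%g.
  by elim: m => [|m IHm]; rewrite ?expg0 // expgS; exact: PD.
have nE m : (m%:Z *: (delta_mx 0 i : 'rV[int]_n)) = (zn_gen i ^+ m)%g.
  elim: m => [|m IHm]; first by rewrite scale0r.
  by rewrite intS scalerDl scale1r IHm expgS.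
case: (x 0 i) => m; first by rewrite nE.
by rewrite NegzE scaleNr nE; exact: (PV _ (Pn m.+1)).
Qed.

(** Commutators die in an abelian group, so everything from Gamma^2 on is killed; [p0] guarantees
    that p + 1 is at least 2. *)
Lemma free_eval_zn x : lower_central (free_group n) p.+1 x -> free_eval zn_gen x = 1%g.
Proof.
pose H k := if k is k'.+2 then [set x | free_eval zn_gen x = 1%g]
  else [set: free_group n].
have key : forall k x, lower_central (free_group n) k.+1 x -> H k.+1 x.
  apply: lower_central_sub => // [[|k]|[|k] {}x y _].
  - exact/group_closedE.
  - apply/group_closedE; split=> [|a b /= a1 b1]; first exact: morph1g (free_evalM _).
    by rewrite /= free_evalM (morphVg (free_evalM _)) a1 b1 invg1 mulg1.
  - rewrite /H /= (morphRg (free_evalM _)); apply/eqP/commgP; exact: zn_mulC.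
  - rewrite /H /= (morphRg (free_evalM _)); apply/eqP/commgP; exact: zn_mulC.
by move=> /key; case: (p) p0.
Qed.

Definition zn_pi : Q -> Zn n := nil_eval zn_gen.

Lemma zn_piM : {morph zn_pi : x y / (x * y)%g}.
Proof. exact: (nil_evalM free_eval_zn). Qed.

Lemma zn_pi_gen i : zn_pi (nil_gen p.+1 i) = zn_gen i.
Proof. exact: (nil_eval_gen free_eval_zn). Qed.

Lemma zn_pi_onto z : exists x, zn_pi x = z.
Proof.
move: z; apply: zn_ind => [|x y [x' <-] [y' <-]|i].
- by exists 1%g; exact: morph1g zn_piM.
- by exists (x' / y')%g; rewrite zn_piM (morphVg zn_piM).
- by exists (nil_gen p.+1 i); exact: zn_pi_gen.
Qed.

Lemma zn_morph_ext (K : groupType) (f1 f2 : Zn n -> K) :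
  {morph f1 : x y / (x * y)%g} -> {morph f2 : x y / (x * y)%g} ->
  (forall i, f1 (zn_gen i) = f2 (zn_gen i)) -> f1 = f2.
Proof.
move=> f1M f2M f12; apply/funext; apply: (zn_ind (P := fun x => f1 x = f2 x)) => //.
- by rewrite (morph1g f1M) (morph1g f2M).
- by move=> x y fx fy; rewrite f1M f2M (morphVg f1M) (morphVg f2M) fx fy.
Qed.

End FreeAbelianQuotient.

Section ToralHomomorphisms.
Variables (R : realType) (n : nat).
Local Notation C := R[i].
Local Notation K := (SU C 2).
Local Notation G := (SO R 3).
Local Notation rotx := (@rotx R).
Local Notation Z := (Zn n).

Definition torus_hom (t : 'I_n -> R) : Z -> G :=
  fun z => rotx (\sum_i ((z : 'rV[int]_n) 0 i)%:~R * t i).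

Lemma torus_homM t : {morph torus_hom t : x y / (x * y)%g}.
Proof.
move=> x y; rewrite /torus_hom -rotxD -big_split /=; congr rotx.
by apply: eq_bigr => i _; rewrite zn_mulE mxE rmorphD mulrDl.
Qed.

Lemma torus_hom_gen t i : torus_hom t (zn_gen i) = rotx (t i).
Proof.
rewrite /torus_hom (bigD1 i) //= mxE !eqxx mul1r big1 ?addr0 // => j ji.
by rewrite mxE eqxx (negPf ji) mul0r.
Qed.

Lemma torus_hom_toral t (U : K) : toral (conj_act U (torus_hom t)).
Proof. by exists (U^-1)%g => z; rewrite conj_actK mxE. Qed.

Lemma toral_zn (g : Z -> G) : {morph g : x y / (x * y)%g} -> toral g ->
  exists (U : K) t, g = conj_act U (torus_hom t).
Proof.
move=> gM [U Ug]; have [t tE] := choice (fun i => SO3_fix0 (Ug (zn_gen i))).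
exists (U^-1)%g, t; rewrite -[LHS](conj_actK U); congr conj_act.
apply: zn_morph_ext; [exact: conj_act_morph|exact: torus_homM|move=> i].
by rewrite tE torus_hom_gen.
Qed.

(** A torus is abelian, so the homomorphism is determined by the angles of the generators and comes
    from Z^n. *)
Lemma toral_nil p (p0 : (0 < p)%N) (f : free_nilpotent n p.+1 -> G) :
  {morph f : x y / (x * y)%g} -> toral f ->
  exists (U : K) t, f = conj_act U (torus_hom t) \o @zn_pi n p.
Proof.
move=> fM [U Uf]; have [t tE] := choice (fun i => SO3_fix0 (Uf (nil_gen p.+1 i))).
exists (U^-1)%g, t; rewrite -[LHS](conj_actK U).
suff -> : conj_act U f = torus_hom t \o @zn_pi n p by [].
apply: nil_morph_ext; first exact: conj_act_morph.
  by move=> x y; rewrite /= zn_piM // torus_homM.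
by move=> i; rewrite tE /= zn_pi_gen // torus_hom_gen.
Qed.

Lemma rotx_fun_continuous (X : topologicalType) (u : X -> R) :
  continuous u -> continuous (fun x => rotx (u x)).
Proof.
move=> cu; apply: set_type_continuous.
have cc : continuous (fun x => cos (u x)).
  by move=> x; apply: (@continuous_comp _ _ _ u cos); [exact: cu|exact: continuous_cos].
have cs : continuous (fun x => sin (u x)).
  by move=> x; apply: (@continuous_comp _ _ _ u sin); [exact: cu|exact: continuous_sin].
by apply: mx33_continuous => //; try exact: cst_continuous; exact: oppr_fun_continuous.
Qed.

(** Multiplying all angles by s in R gives a path of homomorphisms through the trivial one (s = 0)
    and the given one (s = 1). *)
Lemma toral_component (g : Z -> G) : {morph g : x y / (x * y)%g} -> toral g ->
  @hom_component Z G g.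
Proof.
move=> gM /(toral_zn gM)[U [t ->]].
pose path (s : R) : {ptws Z -> G} := conj_act U (torus_hom (fun i => s * t i)).
have cpath : continuous path.
  apply: ptws_continuous => z; rewrite /path /conj_act /conjg.
  apply: mulg_fun_continuous; first exact: cst_continuous.
  apply: mulg_fun_continuous; last exact: cst_continuous.
  apply: rotx_fun_continuous.
  have -> : (fun s : R => \sum_i ((z : 'rV[int]_n) 0 i)%:~R * (s * t i)) =
      (fun s => s * \sum_i ((z : 'rV[int]_n) 0 i)%:~R * t i).
    by apply/funext => s; rewrite big_distrr; apply: eq_bigr => i _ /=; ring.
  by apply: mulr_fun_continuous; [move=> s; exact: cvg_id|exact: cst_continuous].
have cR : connected (path @` [set: R]).
  apply: connected_continuous_connected; last exact: continuous_subspaceT.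
  by apply/connected_intervalP => x y _ _ z _.
apply: (@connected_component_max _ _ _ _ _ _ cR).
- exists 0 => //; apply/funext => z; rewrite /path /conj_act /torus_hom big1 ?rotx0 ?conj1g //.
  by move=> i _; rewrite mul0r mulr0.
- move=> _ [s _ <-]; exact: (conj_act_morph U (torus_homM _)).
- exists 1 => //; rewrite /path; congr (conj_act U (torus_hom _)).
  by apply/funext => i; rewrite mul1r.
Qed.

Definition trace3 (A : G) : R := \tr (val A).

Lemma trace3J (A B : G) : trace3 (A ^ B)%g = trace3 A.
Proof.
have e : forall A B : G, \tr (val (A * B)%g) = \tr (val (B * A)%g).
  by move=> X Y; exact: mxtrace_mulC.
by rewrite /trace3 /conjg e -mulgA mulgV mulg1.
Qed.

Lemma trace3_1 : trace3 1%g = 3.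
Proof. by rewrite /trace3 /= mxtrace1. Qed.

Lemma trace3_rotx t : trace3 (rotx t) = 1 + cos t *+ 2.
Proof. by rewrite /trace3 /= mx33_trace mulr2n addrA. Qed.

Lemma trace3_kdiag x y : trace3 (kdiag R x y) = (-1) ^+ x + (-1) ^+ y + (-1) ^+ (x (+) y).
Proof. by rewrite /trace3 kdiag_mx33 mx33_trace. Qed.

Lemma trace3_continuous : continuous trace3.
Proof.
have cE i j : continuous (fun A : G => val A i j).
  move=> A; apply: (@continuous_comp _ _ _ (val : G -> 'M[R]_3) (fun M : 'M[R]_3 => M i j)).
    exact: set_val_continuous.
  exact: coord_continuous.
have -> : trace3 = (fun A => val A 0 0 + val A 1 1 + val A 2 2).
  by apply/funext => A; rewrite /trace3 [X in \tr X]mx33_eta mx33_trace.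
by apply: addr_fun_continuous => //; exact: addr_fun_continuous.
Qed.

(** A continuous conjugation invariant that tells a torus from a Klein group: three distinct
    half-turns give -3, whereas a torus gives only nonnegative values. *)
Definition trace_sum (T : groupType) (x y : T) (g : T -> G) : R :=
  trace3 (g x) + trace3 (g y) + trace3 (g (x * y)%g).

Lemma toral_trace_sum (T : groupType) (x y : T) (g : T -> G) :
  {morph g : x y / (x * y)%g} -> toral g -> 0 <= trace_sum x y g.
Proof.
move=> gM [U Ug].
have /SO3_fix0[a ax] := Ug x; have /SO3_fix0[b bx] := Ug y.
have E z : trace3 (g z) = trace3 (conj_act U g z) by rewrite /conj_act trace3J.
rewrite /trace_sum !E (conj_act_morph U gM) ax bx -rotxD !trace3_rotx cosD.
have := cos2Dsin2 a; have := cos2Dsin2 b.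
move: (cos a) (sin a) (cos b) (sin b) => c s c' s' h' h.
pose X := c * c' - s * s'; pose Y := s * c' + c * s'.
have hXY : X ^+ 2 + Y ^+ 2 = 1.
  by transitivity ((c ^+ 2 + s ^+ 2) * (c' ^+ 2 + s' ^+ 2)); [rewrite /X /Y; ring|rewrite h h' mulr1].
have hc : c * X + s * Y = c'.
  by transitivity ((c ^+ 2 + s ^+ 2) * c'); [rewrite /X /Y; ring|rewrite h mul1r].
rewrite -/X; move: (sqr_ge0 (1 + c + X)) (sqr_ge0 (s + Y)) hXY hc.
move: X Y => X Y; rewrite !mulr2n => h1 h2 hXY hc.
(* [3 + 2 (cos a + cos b + cos (a + b))] is [|1 + exp(ia) + exp(i(a+b))|^2]. *)
have -> : 1 + (c + c) + (1 + (c' + c')) + (1 + (X + X)) = (1 + c + X) ^+ 2 + (s + Y) ^+ 2.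
  transitivity (1 + (c ^+ 2 + s ^+ 2) + (X ^+ 2 + Y ^+ 2) + 2 * c + 2 * X + 2 * (c * X + s * Y)).
    by rewrite h hXY hc; ring.
  by ring.
exact: addr_ge0.
Qed.

(** The classification is applied with p = 1, that is, to F_n/Gamma^2. All angles are then
    2-torsion, so only Klein images remain. Their elements have trace 3 or -1, and the sum over x,
    y, xy is 9, 1 or -3. *)
Lemma nontoral_abelian (g : Z -> G) : {morph g : x y / (x * y)%g} -> ~ toral g ->
  (forall x y, trace_sum x y g <> -1) /\ exists x y, trace_sum x y g = -3.
Proof.
move=> gM nt; pose f := g \o @zn_pi n 1.
have fM : {morph f : x y / (x * y)%g} by move=> x y; rewrite /f /= zn_piM // gM.
have ntf : ~ toral f.
  move=> [U Uf]; apply: nt; exists U => z.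
  by have [x <-] := zn_pi_onto (n := n) (isT : (0 < 1)%N) z; exact: Uf.
have [[s sS _]|[s sS [U Us]]] := nontoral_conj_normal (isT : (0 < 1)%N) fM ntf.
  have [_ [l]] := S4P sS; case; apply: (@rotx_zangle_eq1 R 1) => //.
  by rewrite -rotx_zangle_double //; exact: rotx_zangle_exp.
have E x : trace3 (f x) = trace3 (@hom8 R n 1 s x) by rewrite -Us /conj_act trace3J.
have hM := @hom8M R n 1 isT s.
split=> [x y|].
  have [x' <-] := zn_pi_onto (n := n) (isT : (0 < 1)%N) x.
  have [y' <-] := zn_pi_onto (n := n) (isT : (0 < 1)%N) y.
  rewrite /trace_sum -zn_piM // -![g _]/(f _) !E hM.
  have /klein_kdiag[a [b ->]] := @hom8_klein R n 1 isT s x'.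
  have /klein_kdiag[c [d ->]] := @hom8_klein R n 1 isT s y'.
  rewrite kdiagM !trace3_kdiag.
  by case: a b c d => [] [] [] []; rewrite /= ?expr0 ?expr1; lra.
have [x xE] := @hom8_onto R n 1 isT s sS true false; have [y yE] := @hom8_onto R n 1 isT s sS false true.
exists (@zn_pi n 1 x), (@zn_pi n 1 y).
rewrite /trace_sum -zn_piM // -![g _]/(f _) !E hM xE yE kdiagM !trace3_kdiag /=.
by rewrite ?expr0 ?expr1; ring.
Qed.

Lemma hom_componentP (g : Z -> G) :
  @hom_component Z G g <-> {morph g : x y / (x * y)%g} /\ toral g.
Proof.
split=> [gC|[gM gt]]; last exact: toral_component.
have CM h : @hom_component Z G h -> {morph h : x y / (x * y)%g}.
  by move=> /connected_component_sub.
split; first exact: CM.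
apply: contrapT => nt; have [_ [x [y xy]]] := nontoral_abelian (CM _ gC) nt.
have cphi : continuous (trace_sum x y : {ptws Z -> G} -> R).
  have c z : continuous (fun h : {ptws Z -> G} => trace3 (h z)).
    move=> h; apply: (@continuous_comp _ _ _ (fun h : {ptws Z -> G} => h z) trace3).
      exact: ptws_proj_continuous.
    exact: trace3_continuous.
  apply: addr_fun_continuous; last exact: c.
  by apply: addr_fun_continuous; exact: c.
have /connected_intervalP I : connected (trace_sum x y @` (@hom_component Z G)).
  apply: connected_continuous_connected; first exact: component_connected.
  exact: continuous_subspaceT.
have C1 : @hom_component Z G (fun=> 1%g).
  by apply: connected_component_refl => u v; rewrite mulg1.
have E1 : (trace_sum x y @` (@hom_component Z G)) (trace_sum x y (fun=> 1%g)).
  by exists (fun=> 1%g).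
have E2 : (trace_sum x y @` (@hom_component Z G)) (trace_sum x y g) by exists g.
(* On the connected component the sum would go from 9 at the trivial homomorphism to -3, hence pass
   through -1, a value that neither kind of homomorphism takes. *)
have /(I _ _ E2 E1)[h hC hE] : trace_sum x y g <= -1 <= trace_sum x y (fun=> 1%g).
  by rewrite xy /trace_sum trace3_1; apply/andP; split; lra.
have [ht|hnt] := pselect (toral h).
  by have := toral_trace_sum x y (CM _ hC) ht; rewrite hE; lra.
by have [/(_ x y)] := nontoral_abelian (CM _ hC) hnt.
Qed.

End ToralHomomorphisms.

(** * The decomposition *)

Section DisjointSums.

Definition disjoint_map (X Y Z : topologicalType) (f : X -> Z) (g : Y -> Z) :
    disjoint_sum X Y -> Z :=
  fun s => match s with existT b x =>
    (if b as b return ((if b then X else Y) -> Z) then f else g) x end.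

Lemma disjoint_map_continuous (X Y Z : topologicalType) (f : X -> Z) (g : Y -> Z) :
  continuous f -> continuous g -> continuous (disjoint_map f g).
Proof. by move=> cf cg [[] x] A; [exact: cf|exact: cg]. Qed.

Lemma disjoint_map_inj (X Y Z : topologicalType) (f : X -> Z) (g : Y -> Z) :
  injective f -> injective g -> (forall x y, f x <> g y) -> injective (disjoint_map f g).
Proof.
move=> fi gi fg [[] x] [[] y] /= e.
- by rewrite (fi _ _ e).
- by case: (fg x y).
- by case: (fg y x).
- by rewrite (gi _ _ e).
Qed.

Lemma disjoint_sum_compact (X Y : topologicalType) :
  compact [set: X] -> compact [set: Y] -> compact [set: disjoint_sum X Y].
Proof. by move=> cX cY; apply: sigT_compact => [|[]//]; exact: finite_finset. Qed.

Lemma copies_compact k (X : topologicalType) :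
  compact [set: X] -> compact [set: copies k X].
Proof. by move=> cX; apply: sigT_compact => //; exact: finite_finset. Qed.

End DisjointSums.

(** * Orbits as families of coset spaces *)

Section OrbitFamily.
Variables (R : realType) (T : groupType) (m : nat).
Local Notation K := (SU R[i] 2).
Local Notation G := (SO R 3).
Local Notation X := (set_type (@hom_space T G)).
Variables (H : groupClosed K) (b : 'I_m -> T -> G).
Hypothesis bM : forall i, {morph b i : x y / (x * y)%g}.
Hypothesis bH : forall i U, conj_act U (b i) = b i <-> U \in H.
Hypothesis b_inj : forall i j U, conj_act U (b i) = b j -> i = j.

(** The choice made by [repr] is immaterial, since by [bH] the subgroup [H] is the exact stabiliser
    of each [b i]. *)
Definition orbit_map (s : copies m (coset_space H)) : X :=
  exist (fun f => f \in @hom_space T G) (conj_act (repr (projT2 s)) (b (projT1 s)))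
    (mem_set (conj_act_morph (repr (projT2 s)) (bM (projT1 s)))).

Lemma coset_eqP (U V : K) :
  \pi_(left_cosets H) U = \pi_(left_cosets H) V <-> (U^-1 * V)%g \in H.
Proof. by split=> [/(@eqquotP _ (coset_equiv H))|?]; [|exact/(@eqquotP _ (coset_equiv H))]. Qed.

Lemma conj_act_eqP i (U V : K) :
  conj_act U (b i) = conj_act V (b i) <-> (U^-1 * V)%g \in H.
Proof.
rewrite -(bH i) conj_actM; split=> [<-|]; first exact: conj_actK.
by move=> /(congr1 (conj_act U)); rewrite -conj_actM mulgV conj_act1 => ->.
Qed.

(** By the quotient topology it is enough to look at the composite with the projection, which is
    conjugation of a fixed homomorphism by a variable element of SU(2). *)
Lemma orbit_map_continuous : continuous orbit_map.
Proof.
have ci i : continuous (fun c : coset_space H => orbit_map (existT _ i c)).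
  apply/quotient_continuous; apply: set_type_continuous.
  have -> : val \o ((fun c : coset_space H => orbit_map (existT _ i c)) \o
      \pi_(coset_space H)) = (fun U : K => conj_act U (b i) : {ptws T -> G}).
    apply/funext => U /=; apply/conj_act_eqP/coset_eqP; exact: reprK.
  exact: conj_act_continuous.
by move=> [i c] A; exact: (ci i c A).
Qed.

Lemma orbit_map_inj : injective orbit_map.
Proof.
move=> [i c] [j d] /(congr1 val) /= e.
have ij : i = j.
  by apply: (@b_inj _ _ ((repr d)^-1 * repr c)%g); rewrite conj_actM e conj_actK.
subst j; congr existT; move: e => /conj_act_eqP/coset_eqP.
by rewrite !reprK.
Qed.

Lemma orbit_map_onto (f : X) i U : conj_act U (b i) = val f ->
  exists s, orbit_map s = f.
Proof.
move=> Uf; exists (existT _ i (\pi_(left_cosets H) U)); apply: val_inj => /=.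
rewrite -Uf; apply/conj_act_eqP/coset_eqP; exact: reprK.
Qed.

Lemma orbit_mapE s : exists i U, val (orbit_map s) = conj_act U (b i).
Proof. by exists (projT1 s), (repr (projT2 s)). Qed.

End OrbitFamily.

Section ToralPart.
Variables (R : realType) (n p : nat).
Hypothesis p0 : (0 < p)%N.
Local Notation G := (SO R 3).
Local Notation Q := (free_nilpotent n p.+1).
Local Notation X := (set_type (@hom_space Q G)).
Local Notation Y := (set_type (@hom_component (Zn n) G)).

Fact toral_map_subproof (g : Y) : (val g \o @zn_pi n p : Q -> G) \in @hom_space Q G.
Proof.
have /hom_componentP[gM _] := set_valP g; apply/mem_set => x y /=.
by rewrite zn_piM // gM.
Qed.

Definition toral_map (g : Y) : X :=
  exist (fun f => f \in @hom_space Q G) _ (toral_map_subproof g).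

Lemma toral_map_continuous : continuous toral_map.
Proof.
apply: set_type_continuous; apply: ptws_continuous => x g.
apply: (@continuous_comp _ _ _ (val : Y -> {ptws Zn n -> G}) (fun h => h (@zn_pi n p x))).
  exact: set_val_continuous.
exact: ptws_proj_continuous.
Qed.

Lemma toral_map_inj : injective toral_map.
Proof.
move=> g h /(congr1 val) /= gh; apply: val_inj; apply/funext => z.
by have [x <-] := zn_pi_onto p0 z; have := congr1 (fun f => f x) gh.
Qed.

Lemma toral_map_toral g : toral (val (toral_map g)).
Proof.
by have /hom_componentP[_ [U Ug]] := set_valP g; exists U => x; exact: Ug.
Qed.

Lemma toral_map_onto (f : X) : toral (val f) -> exists g, toral_map g = f.
Proof.
move=> /(toral_nil p0 (set_valP f))[U [t fE]].
have gC : @hom_component (Zn n) G (conj_act U (torus_hom t)).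
  apply/hom_componentP; split; [exact/conj_act_morph/torus_homM|exact: torus_hom_toral].
exists (exist (fun g => g \in @hom_component (Zn n) G) _ (mem_set gC)).
by apply: val_inj; rewrite fE.
Qed.

End ToralPart.

Theorem corollary3 (R : realType) (q n : nat) (hq : (2 <= q)%N) (hn : (2 <= n)%N) :
  homeomorphic
    (set_type (@hom_space (free_nilpotent n q) (SO R 3)))
    (disjoint_sum
      (disjoint_sum
        (set_type (@hom_component (Zn n) (SO R 3)))
        (copies (nb_Q8 n) (coset_space (@Q8 R[i]))))
      (copies (nb_mu4 n q) (coset_space (@mu4 R[i])))).
Proof.
(* From here on q is p + 1, so that the angles live in Z/2^p. *)
case: q hq => // p p0; have {}p0 : (0 < p)%N by [].
have [r8 [r8S r8_inj r8_onto]] := imset_reps (card_phi8_nb (ltnW hn)).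
have [r4 [r4S r4_inj r4_onto]] := imset_reps (card_phi4_nb p0 hn).
pose b8 i := @hom8 R n p (r8 i); pose b4 i := hom4 R (r4 i).
have b8M i : {morph b8 i : x y / (x * y)%g} by exact: hom8M.
have b4M i : {morph b4 i : x y / (x * y)%g} by exact: hom4M.
have b8H i U : conj_act U (b8 i) = b8 i <-> U \in @Q8 R[i].
  rewrite hom8_stabP //; split=> [h|h]; [exact: mem_set|exact: set_mem].
have b4H i U : conj_act U (b4 i) = b4 i <-> U \in @mu4 R[i].
  rewrite hom4_stabP //; split=> [h|h]; [exact: mem_set|exact: set_mem].
have b8_inj i j U : conj_act U (b8 i) = b8 j -> i = j.
  by move=> h; apply/r8_inj/(hom8_conjP R p0 (r8S i) (r8S j)); exists U.
have b4_inj i j U : conj_act U (b4 i) = b4 j -> i = j.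
  by move=> h; apply/r4_inj/(hom4_conjP R p0 (r4S i) (r4S j)); exists U.
pose o8 := orbit_map (H := @Q8 R[i]) b8M; pose o4 := orbit_map (H := @mu4 R[i]) b4M.
pose F := disjoint_map (disjoint_map (toral_map p0) o8) o4.
apply: (@compact_hausdorff_homeomorphic _ _ F).
- have cK := @compact_SU2 R.
  apply: disjoint_sum_compact; last exact/copies_compact/coset_space_compact.
  apply: disjoint_sum_compact; last exact/copies_compact/coset_space_compact.
  by apply: hom_component_compact; [exact: hausdorff_SO|exact: compact_SO3].
- apply: hausdorff_set_type; apply: (@hausdorff_product _ (fun=> SO R 3)) => _.
  exact: hausdorff_SO.
- apply: disjoint_map_continuous; last exact: orbit_map_continuous.
  apply: disjoint_map_continuous; last exact: orbit_map_continuous.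
  exact: toral_map_continuous.
- have o8E s : exists i U, val (o8 s) = conj_act U (b8 i) by exact: orbit_mapE.
  have o4E s : exists i U, val (o4 s) = conj_act U (b4 i) by exact: orbit_mapE.
  have t8 g s : toral_map p0 g <> o8 s.
    move=> /(congr1 val) e; have [i [U sE]] := o8E s.
    apply: (hom8_nontoral p0 (r8S i)); apply: (@toral_conj _ _ U).
    by rewrite -[conj_act _ _]sE -e; exact: toral_map_toral.
  have t4 g s : toral_map p0 g <> o4 s.
    move=> /(congr1 val) e; have [i [U sE]] := o4E s.
    apply: (hom4_nontoral p0 (r4S i)); apply: (@toral_conj _ _ U).
    by rewrite -[conj_act _ _]sE -e; exact: toral_map_toral.
  (* All squares are trivial in a Klein image, but not in an image of the other family. *)
  have o84 s t : o8 s <> o4 t.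
    move=> /(congr1 val); have [i [U ->]] := o8E s; have [j [V ->]] := o4E t.
    have [x] := hom4_sqr R p0 (r4S j) => x2 e; apply: x2.
    have {}e : hom4 R (r4 j) = conj_act (V^-1 * U)%g (b8 i).
      by rewrite conj_actM e conj_actK.
    by rewrite e /conj_act -conjMg hom8_sqr // conj1g.
  apply: disjoint_map_inj; [|exact: orbit_map_inj|].
    by apply: disjoint_map_inj => //; [exact: toral_map_inj|exact: orbit_map_inj].
  by move=> [[] x] y /=; [exact: t4|exact: o84].
- move=> f; have [/(toral_map_onto p0)[g gf]|nt] := pselect (toral (val f)).
    by exists (existT _ true (existT _ true g)).
  have [[s sS [U Us]]|[s sS [U Us]]] := nontoral_conj_normal p0 (set_valP f) nt.
    have [i is_] := r4_onto s sS.
    (* The normal form found need not be the chosen representative of its class; [V] conjugates the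
       representative to it. *)
    have [V Vs] : exists V, conj_act V (b4 i) = hom4 R s by exact/hom4_conjP.
    have [|t <-] := @orbit_map_onto _ _ _ (@mu4 R[i]) b4 b4M b4H f i (U * V)%g.
      by rewrite conj_actM Vs.
    by exists (existT _ false t).
  have [i is_] := r8_onto s sS.
  have [V Vs] : exists V, conj_act V (b8 i) = hom8 R s by exact/hom8_conjP.
  have [|t <-] := @orbit_map_onto _ _ _ (@Q8 R[i]) b8 b8M b8H f i (U * V)%g.
    by rewrite conj_actM Vs.
  by exists (existT _ true (existT _ false t)).
Qed.
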